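(* Let $0<k<1$ and let $w$ be a real number such that $w/K$ is irrational. Let $\Phi_n^{(C)}(z)$, $n=0,1,2,\dots$, be the monic polynomials determined by the reflection parameters $$a_{2n}=\mathrm{cn}(w(2n+1)),\qquad a_{2n+1}=-\mathrm{dn}(w(2n+2)),\qquad n=0,1,2,\dots$$ Then these polynomials satisfy the orthogonality property on the unit circle $$\sum_{s=-\infty}^{\infty}\rho_s\,\Phi_n^{(C)}(z_s)\,\Phi_m^{(C)}(1/z_s)=h_n\,\delta_{nm},\qquad n,m=0,1,2,\dots,$$ where $$z_s=\exp\bigl(i\pi w(s-1/2)/K\bigr)$$ and the discrete weights are $$\rho_s=\frac{\pi}{kK}\,\frac{1}{q^{s-1/2}+q^{-s+1/2}}.$$
   Context: The functions $\mathrm{sn},\mathrm{cn},\mathrm{dn}$ are the Jacobi elliptic functions with modulus $k$. $K=K(k)$ is the complete elliptic integral of the first kind, $K'=K(k')$ with $k'^2=1-k^2$, and $q=\exp(-\pi K'/K)$. The monic polynomials $\Phi_n$ determined by a real sequence of reflection parameters $a_n$ are defined by $\Phi_0(z)=1$ and $\Phi_{n+1}(z)=z\Phi_n(z)-a_n z^n\Phi_n(1/z)$, $n\ge 0$ (so $a_n=-\Phi_{n+1}(0)$). The normalization constants are $h_0=1$ and $h_n=\prod_{j=0}^{n-1}(1-a_j^2)$. *)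

(* Defs.v *)
From HB Require Import structures.
From mathcomp Require Export all_boot all_order all_algebra complex.
From mathcomp Require Export all_classical all_reals all_analysis.
Export Order.TTheory GRing.Theory Num.Theory numFieldNormedType.Exports.

Set Implicit Arguments.
Unset Strict Implicit.
Unset Printing Implicit Defensive.

Global Open Scope classical_set_scope.
Global Open Scope ring_scope.

Definition elliptic_integrand (R : realType) (k t : R) : R :=
  (Num.sqrt (1 - k ^+ 2 * sin t ^+ 2))^-1.

(* The incomplete integral F(phi, k), oriented: for 0 <= phi the second
   integral is over a null set, for phi <= 0 the first one is. *)
Definition ellipticF (R : realType) (k phi : R) : R :=
  \int[lebesgue_measure]_(t in `[0, phi]) elliptic_integrand k t
  - \int[lebesgue_measure]_(t in `[phi, 0]) elliptic_integrand k t.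

Definition ellipticK (R : realType) (k : R) : R := ellipticF k (pi / 2).

Definition ellipticK' (R : realType) (k : R) : R :=
  ellipticK (Num.sqrt (1 - k ^+ 2)).

Definition nome (R : realType) (k : R) : R :=
  expR (- pi * ellipticK' k / ellipticK k).

(* The amplitude: for 0 < k < 1, F(-, k) is an increasing bijection of the real
   line, so that there is exactly one phi with F(phi, k) = u. *)
Definition jacobi_am (R : realType) (k u : R) : R :=
  xget 0 [set phi | ellipticF k phi = u].

Definition jacobi_sn (R : realType) (k u : R) : R := sin (jacobi_am k u).

Definition jacobi_cn (R : realType) (k u : R) : R := cos (jacobi_am k u).

Definition jacobi_dn (R : realType) (k u : R) : R :=
  Num.sqrt (1 - k ^+ 2 * jacobi_sn k u ^+ 2).

(* z^n p(1/z) as a polynomial, for p of degree at most n; see [horner_reversal]. *)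
Definition reversal (R : nzRingType) (n : nat) (p : {poly R}) : {poly R} :=
  \poly_(i < n.+1) p`_(n - i).

Fixpoint Phi (R : nzRingType) (a : nat -> R) (n : nat) : {poly R} :=
  if n is n'.+1 then 'X * Phi a n' - a n' *: reversal n' (Phi a n') else 1.

Definition hnorm (R : nzRingType) (a : nat -> R) (n : nat) : R :=
  \prod_(j < n) (1 - a j ^+ 2).

Definition evalC (R : realType) (p : {poly R}) (z : R[i]) : R[i] :=
  (map_poly (real_complex R) p).[z].

Definition expi (R : realType) (t : R) : R[i] := (cos t +i* sin t)%C.

Definition node (R : realType) (k w : R) (s : int) : R[i] :=
  expi (pi * w * (s%:~R - 2^-1) / ellipticK k).

Definition weight (R : realType) (k : R) (s : int) : R :=
  pi / (k * ellipticK k)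
  * (nome k `^ (s%:~R - 2^-1) + nome k `^ (- s%:~R + 2^-1))^-1.

(* The doubly infinite series of the f s, s in Z, converges with sum l: its two
   halves s >= 0 and s < 0 converge separately. The topology on the complex
   numbers is that of the modulus, carried by the regular module R[i]^o. *)
Definition zsum_to (R : realType) (f : int -> R[i]) (l : R[i]) : Prop :=
  exists lp ln : R[i],
    [/\ series (fun j : nat => f j%:Z : R[i]^o) @ \oo --> (lp : R[i]^o),
        series (fun j : nat => f (- j.+1%:Z) : R[i]^o) @ \oo --> (ln : R[i]^o)
      & l = lp + ln].

Lemma horner_reversal (F : fieldType) (n : nat) (p : {poly F}) (z : F) :
  (size p <= n.+1)%N -> z != 0 -> (reversal n p).[z] = z ^+ n * p.[z^-1].
Proof.
move=> szp z0; rewrite horner_poly (horner_coef_wide _ szp) mulr_sumr.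
rewrite (reindex_inj rev_ord_inj) /=; apply: eq_bigr => i _.
rewrite subSS subKn -1?ltnS// mulrCA; congr (_ * _).
by rewrite exprVn expfB_cond// (negbTE z0) /= add0n -ltnS.
Qed.

Lemma map_reversal (R S : nzRingType) (f : {rmorphism R -> S}) (n : nat)
    (p : {poly R}) :
  map_poly f (reversal n p) = reversal n (map_poly f p).
Proof.
apply/polyP => i; rewrite coef_map /= [in RHS]coef_poly coef_map coef_poly.
by case: ifP => _; rewrite ?rmorph0.
Qed.

Lemma size_Phi (R : nzRingType) (a : nat -> R) (n : nat) :
  size (Phi a n) = n.+1 /\ Phi a n \is monic.
Proof.
elim: n => [|n [szn mon]] /=; first by rewrite size_poly1 monic1.
have szX : size ('X * Phi a n) = n.+2.
  by rewrite -commr_polyX size_mulX ?monic_neq0// szn.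
have szr : leq (size (- (a n *: reversal n (Phi a n)))).+1 (size ('X * Phi a n)).
  rewrite szX ltnS size_polyN (leq_trans (size_scale_leq _ _))//.
  exact: size_poly.
rewrite size_polyDl// szX; split=> //.
by rewrite monicE lead_coefDl// -commr_polyX lead_coefMX -monicE.
Qed.

Lemma evalC_Phi (R : realType) (a : nat -> R) (n : nat) (z : R[i]) : z != 0 ->
  evalC (Phi a n.+1) z
  = z * evalC (Phi a n) z
    - real_complex R (a n) * (z ^+ n * evalC (Phi a n) z^-1).
Proof.
move=> z0; rewrite /evalC /= rmorphB rmorphM /= map_polyX map_polyZ map_reversal.
rewrite !hornerE horner_reversal//; first by rewrite /= mulrA.
by apply: leq_trans (size_poly _ _) _; rewrite (size_Phi a n).1.
Qed.

(* Main.v *)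
Require Import Defs.
From mathcomp Require Import ring lra zify.

(** Why the theorem holds. Up to the factor pi / (k K), the weights are the
    coefficients 1 / (q^(s-1/2) + q^(1/2-s)) of the Fourier series of cn; hence
    the moments of the discrete measure are c_j = cn (w j) [weight_cos,
    weight_sin]. Given these moments, orthogonality is algebraic. Let f_n (u)
    be the integral of Phi_n against z^(-u/w), that is, the combination of the
    cn (w l - u) with the coefficients of Phi_n [second_kind]. The recurrence of
    the polynomials reads f_(n+1) (u) = f_n (u - w) - a_n f_n (n w - u), and
    the addition theorems
      cn (u - v) = cn u cn v + sn u sn v dn (u - v),
      dn (u - v) = dn u dn v + k^2 sn u sn v cn (u - v)
    show that f_n (u) is a constant multiple of
    sn (u) sn (u - w) ... sn (u - (n-1) w) times cn or dn of u - n w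
    [second_kindE]. The zeros of this product are the orthogonality relations,
    and its value at u = n w is h_n [Phi_gram].

    The analytic part identifies the Jacobi functions, which are defined by
    inversion of the elliptic integral, with Fourier series in the nome, on the
    real line only. For p > 0 consider the series cn, sn, dn with coefficients
    1 / (2 cosh), 1 / (2 sinh), 1 / (2 cosh) at the odd, odd and even multiples
    of p. Their convolutions reduce to sums of shifted tanh and coth, whose
    increments telescope [conv_cn_dn, conv_sn_dn, conv_sn_cn]; this gives the system
    sn' = 2 cn dn, cn' = - 2 sn dn, dn' = - 2 sn cn [is_derive_sn_series], for
    trigonometric modes, and the same system with other signs for hyperbolic
    modes, which describes the imaginary axis. The trigonometric solution is
    parametrized by an amplitude that inverts the elliptic integral of modulus
    cn (0) / dn (0), with K = pi dn (0) [ellipticF_amplitude,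
    ellipticK_series_modulus]. The hyperbolic solution inverts the integral of
    the complementary modulus up to the edge of the strip of convergence, with
    K' = 2 p dn (0) [ellipticK_series_comodulus]. So the nome of the series is
    exp (- pi K' / K), and since K' / K is strictly monotone in the modulus,
    every modulus between 0 and 1 is reached from its own nome
    [nome_exponentK]. *)

Set Implicit Arguments.
Unset Strict Implicit.
Unset Printing Implicit Defensive.

(** * Two-sided series *)

Section TwoSidedSeries.
Variable R : realType.
Implicit Types (f g b : int -> R) (c : R) (i j : int).

Definition zpair f (n : nat) : R := f n%:Z + f (- n.+1%:Z).

(** The limit of the sums over the windows [-n, n[; zpair f n is what the window
    gains from n to n + 1. *)
Definition zsum f : R := limn (series (zpair f)).

Definition zsummable f : Prop :=
  cvgn (series (zpair (fun i => `|f i|))).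

Lemma zpair_le f g : (forall i, f i <= g i) -> forall n, zpair f n <= zpair g n.
Proof. by move=> fg n; rewrite lerD. Qed.

Lemma zpair_norm f n : `|zpair f n| <= zpair (fun i => `|f i|) n.
Proof. exact: ler_normD. Qed.

Lemma zsummable_norm_le f g :
  (forall i, `|f i| <= `|g i|) -> zsummable g -> zsummable f.
Proof.
move=> fg gs; apply: (series_le_cvg _ _ _ gs) => n.
- by rewrite addr_ge0.
- by rewrite addr_ge0.
- exact: zpair_le.
Qed.

Lemma zsummable_le f g :
  (forall i, `|f i| <= g i) -> zsummable g -> zsummable f.
Proof.
by move=> fg; apply: zsummable_norm_le => i; exact: le_trans (fg i) (ler_norm _).
Qed.

Lemma zsum_cvg f : zsummable f -> series (zpair f) @ \oo --> zsum f.
Proof.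
move=> fs; apply: normed_cvg; apply: (series_le_cvg _ _ _ fs) => n //=.
- by rewrite addr_ge0.
- exact: zpair_norm.
Qed.

Lemma zsum_unique f (l : R) : series (zpair f) @ \oo --> l -> zsum f = l.
Proof. exact: cvg_lim. Qed.

Lemma eq_zsum f g : (forall i, f i = g i) -> zsum f = zsum g.
Proof. by move=> fg; congr zsum; apply/funext. Qed.

Lemma eq_zsummable f g : zsummable f -> (forall i, f i = g i) -> zsummable g.
Proof. by move=> fs fg; rewrite (_ : g = f)//; apply/funext. Qed.

Lemma zsummableZ c f : zsummable f -> zsummable (fun i => c * f i).
Proof.
move=> fs; rewrite /zsummable.
have -> : series (zpair (fun i => `|c * f i|)) =
          `|c| \*: series (zpair (fun i => `|f i|)).
  apply/funext => n; rewrite /series /= scaler_sumr; apply: eq_bigr => i _.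
  by rewrite /zpair !normrM -mulrDr.
exact: is_cvgZl_tmp.
Qed.

Lemma zsummableD f g :
  zsummable f -> zsummable g -> zsummable (fun i => f i + g i).
Proof.
move=> fs gs; apply: (@zsummable_le _ (fun i => `|f i| + `|g i|)).
  by move=> i; exact: ler_normD.
rewrite /zsummable.
have -> : series (zpair (fun i => `| `|f i| + `|g i| |)) =
    series (zpair (fun i => `|f i|)) \+ series (zpair (fun i => `|g i|)).
  apply/funext => n; rewrite /series /= -big_split /=; apply: eq_bigr => i _.
  rewrite /zpair; do 2 rewrite (ger0_norm (addr_ge0 (normr_ge0 _) (normr_ge0 _))).
  by ring.
exact: is_cvgD.
Qed.

Lemma zsummable_norm f : zsummable f -> zsummable (fun i => `|f i|).
Proof. by apply: zsummable_norm_le => i; rewrite normr_id. Qed.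

Lemma zsummable0 : zsummable (fun=> 0).
Proof.
rewrite /zsummable (_ : series _ = cst 0); first exact: is_cvg_cst.
apply/funext => n; rewrite /series /= big1// => i _.
by rewrite /zpair normr0 addr0.
Qed.

Lemma zsum0 : zsum (fun=> 0) = 0.
Proof.
apply: zsum_unique; rewrite (_ : series _ = cst 0); first exact: cvg_cst.
by apply/funext => n; rewrite /series /= big1// => i _; rewrite /zpair addr0.
Qed.

Lemma zsumZ c f : zsummable f -> zsum (fun i => c * f i) = c * zsum f.
Proof.
move=> fs; apply: zsum_unique.
have -> : series (zpair (fun i => c * f i)) = c \*: series (zpair f).
  apply/funext => n; rewrite /series /= scaler_sumr; apply: eq_bigr => i _.
  by rewrite /zpair -mulrDr.
by apply: cvgZl_tmp; exact: zsum_cvg.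
Qed.

Lemma zsumD f g : zsummable f -> zsummable g ->
  zsum (fun i => f i + g i) = zsum f + zsum g.
Proof.
move=> fs gs; apply: zsum_unique.
have -> : series (zpair (fun i => f i + g i)) = series (zpair f) \+ series (zpair g).
  apply/funext => n; rewrite /series /= -big_split /=; apply: eq_bigr => i _.
  by rewrite /zpair; ring.
by apply: cvgD; exact: zsum_cvg.
Qed.

Lemma zsumN f : zsummable f -> zsum (fun i => - f i) = - zsum f.
Proof. by move=> fs; rewrite -mulN1r -zsumZ//; apply: eq_zsum => i; rewrite mulN1r. Qed.

Lemma zsummableN f : zsummable f -> zsummable (fun i => - f i).
Proof. by apply: zsummable_norm_le => i; rewrite normrN. Qed.

Lemma zsumB f g : zsummable f -> zsummable g ->
  zsum (fun i => f i - g i) = zsum f - zsum g.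
Proof. by move=> fs gs; rewrite zsumD ?zsumN//; exact: zsummableN. Qed.

Lemma zsummableB f g :
  zsummable f -> zsummable g -> zsummable (fun i => f i - g i).
Proof. by move=> fs gs; apply: zsummableD => //; exact: zsummableN. Qed.

Lemma zsummable_sum (I : Type) (r : seq I) (F : I -> int -> R) :
  (forall t, zsummable (F t)) -> zsummable (fun i => \sum_(t <- r) F t i).
Proof.
move=> Fs; elim: r => [|t r IH].
  by apply: (eq_zsummable zsummable0) => i; rewrite big_nil.
by apply: (eq_zsummable (zsummableD (Fs t) IH)) => i; rewrite big_cons.
Qed.

Lemma zsum_sum (I : Type) (r : seq I) (F : I -> int -> R) :
  (forall t, zsummable (F t)) ->
  zsum (fun i => \sum_(t <- r) F t i) = \sum_(t <- r) zsum (F t).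
Proof.
move=> Fs; elim: r => [|t r IH].
  by rewrite big_nil -[RHS]zsum0; apply: eq_zsum => i; rewrite big_nil.
rewrite big_cons -IH -zsumD//; last exact: zsummable_sum.
by apply: eq_zsum => i; rewrite big_cons.
Qed.

(** A bound on the remainders that depends on the dominating series only: it is
    uniform in any parameter of f. *)
Lemma zsum_tail f b (n : nat) : (forall i, `|f i| <= b i) -> zsummable b ->
  `|zsum f - series (zpair f) n| <= zsum b - series (zpair b) n.
Proof.
move=> fb bs.
have fs : zsummable f by exact: zsummable_le bs.
have Hf : (fun N => `|series (zpair f) N - series (zpair f) n|) @ \oo
    --> `|zsum f - series (zpair f) n|.
  by apply: cvg_norm; apply: cvgB; [exact: zsum_cvg|exact: cvg_cst].
have Hb : (fun N => series (zpair b) N - series (zpair b) n) @ \oo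
    --> zsum b - series (zpair b) n.
  by apply: cvgB; [exact: zsum_cvg|exact: cvg_cst].
rewrite -(cvg_lim _ Hf)// -(cvg_lim _ Hb)//; apply: ler_lim.
- by apply/cvg_ex; eexists; exact: Hf.
- by apply/cvg_ex; eexists; exact: Hb.
near=> N; have nN : (n <= N)%N by near: N; exact: nbhs_infty_ge.
rewrite !sub_series_geq//; apply: le_trans (ler_norm_sum _ _ _) _.
apply: ler_sum => i _; apply: le_trans (ler_normD _ _) _.
exact: lerD.
Unshelve. all: by end_near. Qed.

Lemma series_le_zsum f (n : nat) : (forall i, 0 <= f i) -> zsummable f ->
  series (zpair f) n <= zsum f.
Proof.
move=> f0 fs; rewrite -subr_ge0.
apply: le_trans (zsum_tail (f := f) (b := f) n _ fs); first exact: normr_ge0.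
by move=> i; rewrite ger0_norm.
Qed.

Lemma zsum_gt0 f i : (forall j, 0 <= f j) -> 0 < f i -> zsummable f -> 0 < zsum f.
Proof.
move=> f0 fi fs.
pose n := `|i|%N.
apply: (lt_le_trans _ (series_le_zsum n.+1 f0 fs)).
have: 0 < zpair f n \/ exists2 m, (m < n)%N & 0 < zpair f m.
  rewrite /zpair /n; case: i fi {n} => m fi /=.
    by left; rewrite ltr_wpDr.
  right; exists m => //; by rewrite ltr_wpDl.
have nneg : forall m, 0 <= zpair f m by move=> m; rewrite addr_ge0.
rewrite /series /= big_nat_recr//= => -[H|[m mn H]].
  by rewrite ltr_wpDl// sumr_ge0.
rewrite ltr_wpDr// (bigD1_seq m)//= ?mem_index_iota ?iota_uniq//.
by rewrite ltr_wpDr// sumr_ge0.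
Qed.

(** A shift changes the windows at their two ends only. *)
Lemma zpair_shift f (n : nat) :
  series (zpair (fun i => f (i + 1))) n =
  series (zpair f) n + (f n%:Z - f (- n%:Z)).
Proof.
rewrite /series /=; elim: n => [|n IH].
  by rewrite !big_geq// oppr0 subrr addr0.
rewrite !big_nat_recr//= IH /zpair.
have -> : (n%:Z + 1 = n.+1%:Z)%R by rewrite -addn1 PoszD.
have -> : (- n.+1%:Z + 1 = - n%:Z)%R by lia.
by ring.
Qed.

Lemma zsummable_cvg0 f : zsummable f ->
  (f n%:Z @[n --> \oo] --> (0 : R)) /\
  (f (- n.+1%:Z) @[n --> \oo] --> (0 : R)).
Proof.
move=> fs; have H := cvg_series_cvg_0 fs.
have sq (u v : nat -> R) : (forall n, `|u n| <= v n) ->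
    v @ \oo --> (0 : R) -> u @ \oo --> (0 : R).
  move=> uv v0; apply/norm_cvg0P => /=.
  apply: (@squeeze_cvgr _ _ _ _ (cst 0) v (fun n => `|u n|)) => //; [|exact: cvg_cst].
  by near=> n; rewrite /= normr_ge0 uv.
by split; apply: sq H => n; rewrite /zpair ?lerDl ?lerDr.
Unshelve. all: by end_near. Qed.

Lemma cvg_zsum_shift f (l : R) : series (zpair f) @ \oo --> l ->
  (f n%:Z - f (- n%:Z)) @[n --> \oo] --> (0 : R) ->
  series (zpair (fun i => f (i + 1))) @ \oo --> l.
Proof.
move=> fl f0.
have -> : series (zpair (fun i => f (i + 1))) =
   series (zpair f) \+ (fun n : nat => f n%:Z - f (- n%:Z)).
  by apply/funext => n; rewrite zpair_shift.
by rewrite -[l]addr0; apply: cvgD.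
Qed.

Lemma zsum_shift1 f : zsummable f ->
  zsummable (fun i => f (i + 1)) /\ zsum (fun i => f (i + 1)) = zsum f.
Proof.
have H g : zsummable g -> (g n%:Z - g (- n%:Z)) @[n --> \oo] --> (0 : R).
  move=> gs; have [g1 g2] := zsummable_cvg0 gs.
  by rewrite -[0]subr0; apply: cvgB => //; rewrite -cvg_shiftS.
move=> fs; split.
  apply/cvg_ex; exists (zsum (fun i => `|f i|)).
  have fns := zsummable_norm fs.
  exact: (cvg_zsum_shift (zsum_cvg fns) (H _ fns)).
by apply: zsum_unique; exact: (cvg_zsum_shift (zsum_cvg fs) (H _ fs)).
Qed.

Lemma zsum_reflect1 f : zsum (fun i => f (- 1 - i)) = zsum f.
Proof.
congr (limn (series _)); apply/funext => n; rewrite /zpair addrC; congr (f _ + f _); lia.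
Qed.

Lemma zsummable_reflect1 f : zsummable f -> zsummable (fun i => f (- 1 - i)).
Proof.
move=> fs; rewrite /zsummable (_ : zpair _ = zpair (fun i => `|f i|))//.
apply/funext => n; rewrite /zpair addrC; congr (`|f _| + `|f _|); lia.
Qed.

Lemma zsum_shift_nat f (k : nat) : zsummable f ->
  zsummable (fun i => f (i + k%:Z)) /\ zsum (fun i => f (i + k%:Z)) = zsum f.
Proof.
move=> fs; elim: k => [|k [IH1 IH2]].
  by split; [apply: (eq_zsummable fs)|apply: eq_zsum] => i; rewrite addr0.
have [H1 H2] := zsum_shift1 IH1.
have E i : f (i + 1 + k%:Z) = f (i + k.+1%:Z) by congr f; lia.
by split; [apply: (eq_zsummable H1)|rewrite -IH2 -H2; apply: eq_zsum] => i.
Qed.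

Lemma zsum_reflect f k : zsummable f ->
  zsummable (fun i => f (k - i)) /\ zsum (fun i => f (k - i)) = zsum f.
Proof.
case: k => k fs.
  have [H1 H2] := zsum_shift_nat k.+1 fs.
  have E i : f (- 1 - i + k.+1%:Z) = f (k%:Z - i) by congr f; lia.
  split; first by apply: (eq_zsummable (zsummable_reflect1 H1)) => i.
  by rewrite -H2 -[RHS]zsum_reflect1; apply: eq_zsum => i.
have [H1 H2] := zsum_shift_nat k (zsummable_reflect1 fs).
have E i : f (- 1 - (i + k%:Z)) = f (Negz k - i) by congr f; lia.
split; first by apply: (eq_zsummable H1) => i.
by rewrite -(zsum_reflect1 f) -H2; apply: eq_zsum => i.
Qed.

Lemma zsum_shift f k : zsummable f ->
  zsummable (fun i => f (i + k)) /\ zsum (fun i => f (i + k)) = zsum f.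
Proof.
move=> fs; have [H1 H2] := zsum_reflect k fs.
have [H3 H4] := zsum_reflect 0 H1.
have E i : f (k - (0 - i)) = f (i + k) by congr f; lia.
split; first by apply: (eq_zsummable H3) => i.
by rewrite -H2 -H4; apply: eq_zsum => i.
Qed.

(** Tannery's theorem, along an arbitrary filter: the remainders are uniformly
    small, and finitely many terms converge. Both the exchange of two summations
    and term by term differentiation are instances. *)
Lemma tannery (T : Type) (F : set_system T) {FF : ProperFilter F}
    (u : T -> int -> R) (f b : int -> R) :
  zsummable b -> (\forall t \near F, forall i, `|u t i| <= b i) ->
  (forall i, u t i @[t --> F] --> f i) ->
  zsum (u t) @[t --> F] --> zsum f.
Proof.
move=> bs ub uf.
have fb i : `|f i| <= b i.
  have H : `|u t i| @[t --> F] --> `|f i| by apply: cvg_norm; exact: uf.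
  have := @closed_cvg _ _ F FF (fun t => `|u t i|) [set y | y <= b i]
    (@closed_le _ (b i)) _ _ H.
  by apply; near=> t; rewrite /=; move: (i); near: t.
apply/cvgrPdist_lt => e e0.
have e4 : 0 < e / 4 by rewrite divr_gt0.
have /cvgrPdist_lt/(_ _ e4) := zsum_cvg bs.
case=> N _ /(_ N (leqnn N)) /= Nb.
have Hfin : series (zpair (u t)) N @[t --> F] --> series (zpair f) N.
  apply: cvg_big => [|i _]; first exact: add_continuous.
  by apply: cvgD; exact: uf.
move/cvgrPdist_lt: Hfin => /(_ _ e4) Hfin.
near=> t.
have ubt : forall i, `|u t i| <= b i by near: t.
have H1 := zsum_tail N fb bs.
have H2 := zsum_tail N ubt bs.
have H3 : `|series (zpair f) N - series (zpair (u t)) N| < e / 4 by near: t.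
have H4 := ler_norm (zsum b - series (zpair b) N).
move: H1 H2 H3; rewrite !ler_norml !ltr_norml => /andP[? ?] /andP[? ?] /andP[? ?].
by apply/andP; split; lra.
Unshelve. all: by end_near. Qed.

Lemma zsummable_bounded f : zsummable f -> forall i, `|f i| <= zsum (fun j => `|f j|).
Proof.
move=> fs i; pose n := `|i|%N.
have fns := zsummable_norm fs.
apply: le_trans (series_le_zsum n.+1 _ fns) => //.
have nneg : forall m, 0 <= zpair (fun j => `|f j|) m by move=> m; rewrite addr_ge0.
have: `|f i| <= zpair (fun j => `|f j|) n \/
    exists2 m, (m < n)%N & `|f i| <= zpair (fun j => `|f j|) m.
  rewrite /zpair /n; case: i {n} => m /=.
    by left; rewrite lerDl.
  by right; exists m => //; rewrite lerDr.
rewrite /series /= big_nat_recr//= => -[H|[m mn H]].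
  by apply: le_trans H _; rewrite lerDr sumr_ge0.
rewrite ler_wpDr// (bigD1_seq m)//= ?mem_index_iota ?iota_uniq//.
by rewrite ler_wpDr// sumr_ge0.
Qed.

End TwoSidedSeries.

Section Exchange.
Variable R : realType.

(** The bound has the shape met in convolutions. Partial sums over n commute
    with the sum over m, and Tannery's theorem passes to the limit: a window of
    the shifted series B (n - m) never exceeds the whole sum of B. *)
Lemma zsum_exchange (F : int -> int -> R) (A B : int -> R) :
  zsummable A -> zsummable B ->
  (forall m n, `|F m n| <= `|A m| * `|B (n - m)|) ->
  zsum (fun m => zsum (F m)) = zsum (fun n => zsum (F^~ n)).
Proof.
move=> As Bs FAB.
have BN := zsummable_norm Bs.
have Fm m : zsummable (F m).
  apply: (@zsummable_le _ _ (fun n => `|A m| * `|B (n - m)|)) => //.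
  by apply: zsummableZ; exact: (zsum_shift (- m) BN).1.
have Fn n : zsummable (F^~ n).
  apply: (@zsummable_le _ _ (fun m => zsum (fun j => `|B j|) * `|A m|)).
    move=> m; apply: le_trans (FAB m n) _; rewrite mulrC ler_wpM2r//.
    exact: zsummable_bounded.
  exact/zsummableZ/zsummable_norm.
apply/esym/zsum_unique.
have -> : series (zpair (fun n => zsum (F^~ n))) =
          fun N => zsum (fun m => series (zpair (F m)) N).
  apply/funext => N; rewrite /series /= zsum_sum; last first.
    by move=> i; apply: zsummableD; exact: Fn.
  by apply: eq_bigr => i _; rewrite /zpair zsumD.
apply: (@tannery _ _ _ _ _ _ (fun m => zsum (fun j => `|B j|) * `|A m|)).
- exact/zsummableZ/zsummable_norm.
- near=> N => m; rewrite mulrC.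
  have [H1 H2] := zsum_shift (- m) BN.
  rewrite -H2 -zsumZ//.
  apply: (@le_trans _ _ (series (zpair (fun n => `|A m| * `|B (n - m)|)) N)).
    rewrite /series /=; apply: le_trans (ler_norm_sum _ _ _) _.
    apply: ler_sum => i _; apply: le_trans (zpair_norm _ _) _.
    by apply: zpair_le => j; exact: FAB.
  apply: series_le_zsum; first by move=> i; rewrite mulr_ge0.
  exact: zsummableZ.
- by move=> m; exact: zsum_cvg.
Unshelve. all: by end_near. Qed.

Lemma zsummable_geometric (r : R) : 0 <= r -> r < 1 ->
  zsummable (fun i : int => r ^+ `|i|%N).
Proof.
move=> r0 r1; rewrite /zsummable.
have -> : zpair (fun i : int => `|r ^+ `|i|%N|) = geometric (1 + r) r.
  apply/funext => n; rewrite /zpair !ger0_norm ?exprn_ge0//=.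
  by rewrite mulrDl mul1r exprS.
by apply: is_cvg_geometric_series; rewrite ger0_norm.
Qed.

Lemma zsummable_expR (dl : R) (lam : int -> R) : 0 < dl ->
  (forall i, `|i%:~R| <= `|lam i|) ->
  zsummable (fun i => expR (- (dl * `|lam i|))).
Proof.
move=> dl0 lamge.
have r1 : expR (- dl) < 1 by rewrite expR_lt1 oppr_lt0.
apply: zsummable_le (zsummable_geometric (expR_ge0 _) r1) => i.
rewrite ger0_norm ?expR_ge0// -expRM_natl ler_expR mulrN lerN2 mulrC.
rewrite ler_wpM2l ?(ltW dl0)//; apply: le_trans (lamge i).
by rewrite -intr_norm -abszE natr_absz intr_norm.
Qed.

Lemma MVT_ball (f df : R -> R) (x y : R) :
  (forall z, `|z - x| <= `|y - x| -> is_derive z 1 f (df z)) ->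
  exists2 c, `|c - x| <= `|y - x| & f y - f x = df c * (y - x).
Proof.
move=> fdf.
have cont a b : (forall z, z \in `[a, b] -> `|z - x| <= `|y - x|) ->
    {within `[a, b], continuous f}.
  move=> H; apply: derivable_within_continuous => z zab.
  by have [] := fdf z (H z zab).
have [xy|yx] := leP x y.
  have H z : z \in `[x, y] -> `|z - x| <= `|y - x|.
    by rewrite in_itv /= => /andP[? ?]; rewrite !ger0_norm ?subr_ge0// lerB.
  have [|c cxy ->] := @MVT_segment _ f df x y xy _ (cont _ _ H).
    by move=> z zxy; apply: fdf; apply: H; apply: subset_itv_oo_cc zxy.
  by exists c => //; exact: H.
have H z : z \in `[y, x] -> `|z - x| <= `|y - x|.
  rewrite in_itv /= => /andP[? ?].
  by rewrite !ler0_norm ?subr_le0 ?(ltW yx)// lerN2 lerB.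
have [|c cxy E] := @MVT_segment _ f df y x (ltW yx) _ (cont _ _ H).
  by move=> z zxy; apply: fdf; apply: H; apply: subset_itv_oo_cc zxy.
by exists c; [exact: H|rewrite -opprB E -mulrN opprB].
Qed.

(** By the mean value theorem the difference quotients inherit the bound on the
    derivatives, and Tannery's theorem applies to them. *)
Lemma zsum_is_derive (g dg : int -> R -> R) (b : int -> R) (x0 e : R) : 0 < e ->
  (forall i x, `|x - x0| < e -> is_derive x 1 (g i) (dg i x)) ->
  (forall i x, `|x - x0| < e -> `|dg i x| <= b i) ->
  zsummable b ->
  (forall x, `|x - x0| < e -> zsummable (g^~ x)) ->
  is_derive x0 1 (fun x => zsum (g^~ x)) (zsum (dg^~ x0)).
Proof.
move=> e0 gdg dgb bs gs.
have Ball (h : R) : `|h| < e -> `|h + x0 - x0| < e by rewrite addrK.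
have cvgD : h^-1 *: (zsum (g^~ (h + x0)) - zsum (g^~ x0)) @[h --> 0^'] -->
    zsum (dg^~ x0).
  have near_e : \forall h \near (0:R)^', `|h| < e.
    by apply: cvg_within; exists e => //= h; rewrite /ball /= sub0r normrN.
  have near_ne : \forall h \near (0:R)^', h != 0.
    exact: nbhs_dnbhs_neq.
  have : zsum (fun i => h^-1 * (g i (h + x0) - g i x0)) @[h --> 0^'] -->
    zsum (dg^~ x0).
    apply: (@tannery _ _ _ _ _ _ b) => //.
      near=> h => i.
      have he : `|h| < e by near: h.
      have h0 : h != 0 by near: h.
      have [|c cx ->] := @MVT_ball (g i) (dg i) x0 (h + x0).
        by move=> z zx; apply: gdg; apply: le_lt_trans zx (Ball _ he).
      rewrite addrK mulrC mulfK//; apply: dgb.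
      exact: le_lt_trans cx (Ball _ he).
    move=> i; have := gdg i x0; rewrite subrr normr0 => /(_ e0).
    case=> /cvg_ex[l /= Hl] <-.
    have <- : l = 'D_1 (g i) x0 by apply/esym/cvg_lim.
    apply: cvg_trans Hl; apply: near_eq_cvg; near=> h.
    by rewrite /= [h *: 1]mulr1.
  apply: cvg_trans; apply: near_eq_cvg; near=> h.
  have he : `|h| < e by near: h.
  have gs0 : zsummable (g^~ x0) by apply: gs; rewrite subrr normr0.
  rewrite zsumZ ?zsumB//; first exact/gs/Ball.
  by apply: zsummableB => //; exact/gs/Ball.
suff E : (fun h => h^-1 *: ((fun x => zsum (g^~ x)) (h *: 1 + x0) - zsum (g^~ x0)))
    = (fun h => h^-1 *: (zsum (g^~ (h + x0)) - zsum (g^~ x0))).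
  apply: DeriveDef.
    by apply/cvg_ex; exists (zsum (dg^~ x0)); rewrite /= E.
  by apply: cvg_lim => //=; rewrite E.
by apply/funext => h; rewrite [h *: 1]mulr1.
Unshelve. all: by end_near. Qed.

End Exchange.

(** * Telescoping sums of odd kinks *)

Section Telescoping.
Variable R : realType.
Implicit Types (U V W a : int -> R).

Lemma zsum_telescope W (lN lP : R) :
  W (- n%:Z) @[n --> \oo] --> lN -> W n%:Z @[n --> \oo] --> lP ->
  zsum (fun m => W (m - 1) - W m) = lN - lP.
Proof.
move=> WN WP; apply: zsum_unique; rewrite -(cvg_shiftS (series _)).
have -> : (fun n => series (zpair (fun m => W (m - 1) - W m)) n.+1) =
    (fun n : nat => W (- n.+2%:Z) - W n%:Z).
  apply/funext; elim=> [|n IH].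
    rewrite /series /= big_nat1 /zpair.
    have -> : (- 1%:Z - 1 = - 2%:Z)%R by lia.
    by rewrite sub0r; ring.
  rewrite seriesSr IH /zpair.
  have -> : (n.+1%:Z - 1 = n%:Z)%R by lia.
  have -> : (- n.+2%:Z - 1 = - n.+3%:Z)%R by lia.
  by ring.
apply: cvgB => //.
by have := WN; rewrite -cvg_shiftS -[in X in X -> _]cvg_shiftS.
Qed.

(** The kinks U of interest are samples of tanh and coth, whose distance to 1
    decays exponentially. *)
Lemma odd_kink_cvg U a (k : int) : zsummable a ->
  (forall j, 0 < j -> `|U j - 1| <= 2 * `|a j|) ->
  U (k + n%:Z) @[n --> \oo] --> (1 : R).
Proof.
move=> as_ Ua; have [as2 _] := zsum_shift k (@zsummableZ _ 2 _ (zsummable_norm as_)).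
have [H _] := zsummable_cvg0 as2.
rewrite -[X in _ --> X]addr0; apply/subr_cvg0.
rewrite addr0; apply/norm_cvg0P.
apply: (@squeeze_cvgr _ _ _ _ (cst 0) (fun n : nat => 2 * `|a (n%:Z + k)|)
  (fun n : nat => `|U (k + n%:Z) - 1|)) => //; [|exact: cvg_cst].
near=> n; rewrite /= normr_ge0 /= (addrC k); apply: Ua.
have : (`|k| < n)%N by near: n; exact: nbhs_infty_gt.
by lia.
Unshelve. all: by end_near. Qed.

(** Moving one kink by a full step relative to the other one raises the sum by
    U(+oo) - U(-oo) = 2, because the difference telescopes. *)
Lemma zsum_kink_step U V a (n : int) : zsummable a ->
  (forall j, U (1 - j) = - U j) ->
  (forall j, 0 < j -> `|U j - 1| <= 2 * `|a j|) ->
  (forall n, zsummable (fun m => U (n - m) + V m)) ->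
  zsum (fun m => U (n + 1 - m) + V m) = zsum (fun m => U (n - m) + V m) + 2.
Proof.
move=> as_ Uodd Ua UVs; apply/eqP; rewrite [X in _ == X]addrC -subr_eq -zsumB//; apply/eqP.
rewrite (@eq_zsum _ _ (fun m => U (n - (m - 1)) - U (n - m))); last first.
  by move=> m; rewrite opprB addrA addrAC; ring.
rewrite (@zsum_telescope (fun m => U (n - m)) 1 (-1)); first by ring.
  have -> : (fun m : nat => U (n - - m%:Z)) = (fun m : nat => U (n + m%:Z)).
    by apply/funext => m; rewrite opprK.
  exact: odd_kink_cvg as_ Ua.
have -> : (fun m : nat => U (n - m%:Z)) = (fun m : nat => - U ((1 - n) + m%:Z)).
  by apply/funext => m; rewrite -Uodd; congr U; lia.
by apply: cvgN; exact: odd_kink_cvg as_ Ua.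
Qed.

Lemma int_affine (f : int -> R) : (forall n, f (n + 1) = f n + 2) ->
  forall n, f n = f 0 + (2 * n)%:~R.
Proof.
move=> fS; case; elim=> [|n IH].
- by rewrite mulr0 addr0.
- have -> : n.+1%:Z = n%:Z + 1 by lia.
  by rewrite fS IH mulrDr intrD; ring.
- have := fS (- 1); rewrite addNr => ->.
  by rewrite (_ : Negz 0 = - 1)// mulrN1 intrN; ring.
- have := fS (Negz n.+1); rewrite (_ : Negz n.+1 + 1 = Negz n); last by lia.
  rewrite IH (_ : 2 * Negz n.+1 = 2 * Negz n - 2); last by lia.
  by rewrite intrB => /eqP; rewrite -subr_eq => /eqP <-; ring.
Qed.

End Telescoping.

(** * Hyperbolic coefficients and their convolutions *)

Section Coefficients.
Variable R : realType.
Implicit Types (x y : R) (i j k n : int).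

(** Doubled hyperbolic functions, since the coefficients of the elliptic series
    are 1 / (2 cosh) and 1 / (2 sinh). *)
Definition cosh2 x : R := expR x + expR (- x).
Definition sinh2 x : R := expR x - expR (- x).

Lemma cosh2_gt0 x : 0 < cosh2 x.
Proof. by rewrite addr_gt0 ?expR_gt0. Qed.

Lemma cosh2N x : cosh2 (- x) = cosh2 x.
Proof. by rewrite /cosh2 opprK addrC. Qed.

Lemma sinh2N x : sinh2 (- x) = - sinh2 x.
Proof. by rewrite /sinh2 opprK opprB. Qed.

Lemma sinh2_eq0 x : (sinh2 x == 0) = (x == 0).
Proof.
rewrite subr_eq0; apply/eqP/eqP => [/expR_inj|->]; last by rewrite oppr0.
by move=> xN; lra.
Qed.

Lemma sinh2_gt0 x : 0 < x -> 0 < sinh2 x.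
Proof. by move=> x0; rewrite subr_gt0 ltr_expR; lra. Qed.

Lemma cosh2D x y : 2 * cosh2 (x + y) = cosh2 x * cosh2 y + sinh2 x * sinh2 y.
Proof. by rewrite /cosh2 /sinh2 opprD !expRD; ring. Qed.

Lemma sinh2D x y : 2 * sinh2 (x + y) = sinh2 x * cosh2 y + cosh2 x * sinh2 y.
Proof. by rewrite /cosh2 /sinh2 opprD !expRD; ring. Qed.

(** The odd frequencies change sign under i -> 1 - i, the even ones under
    i -> - i. *)
Definition odd_freq i : R := (2 * i - 1)%:~R.
Definition even_freq i : R := (2 * i)%:~R.

Lemma odd_freq_refl i : odd_freq (1 - i) = - odd_freq i.
Proof. by rewrite /odd_freq -intrN; congr (_%:~R); lia. Qed.

Lemma even_freqN i : even_freq (- i) = - even_freq i.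
Proof. by rewrite /even_freq -intrN; congr (_%:~R); lia. Qed.

Lemma odd_freq_ge i : `|i%:~R| <= `|odd_freq i|.
Proof. by rewrite /odd_freq -!intr_norm ler_int; lia. Qed.

Lemma even_freq_ge i : `|i%:~R| <= `|even_freq i|.
Proof. by rewrite /even_freq -!intr_norm ler_int; lia. Qed.

Lemma odd_freq_norm_ge1 i : 1 <= `|odd_freq i|.
Proof. by rewrite /odd_freq -intr_norm -[1]/(1%:~R) ler_int; lia. Qed.

Lemma odd_freq_neq0 i : odd_freq i != 0.
Proof. by rewrite -normr_gt0; exact: lt_le_trans (odd_freq_norm_ge1 i). Qed.

Lemma odd_freq_gt0 i : 0 < i -> 0 < odd_freq i.
Proof. by move=> i0; rewrite /odd_freq ltr0z; lia. Qed.

Lemma odd_even_freqD n m : odd_freq (n - m) + even_freq m = odd_freq n.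
Proof. by rewrite /odd_freq /even_freq -intrD; congr (_%:~R); lia. Qed.

Lemma odd_odd_freqD n m : odd_freq (n - m) + odd_freq m = even_freq (n - 1).
Proof. by rewrite /odd_freq /even_freq -intrD; congr (_%:~R); lia. Qed.

Variable p : R.
Hypothesis p0 : 0 < p.

(** With q = exp (- 2 p) these are 1 / (q^(i-1/2) + q^(1/2-i)) and its analogues:
    up to constant factors, the Fourier coefficients of cn, sn and dn. *)
Definition cn_coef i : R := (cosh2 (odd_freq i * p))^-1.
Definition sn_coef i : R := (sinh2 (odd_freq i * p))^-1.
Definition dn_coef i : R := (cosh2 (even_freq i * p))^-1.

Lemma cn_coef_refl i : cn_coef (1 - i) = cn_coef i.
Proof. by rewrite /cn_coef odd_freq_refl mulNr cosh2N. Qed.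

Lemma sn_coef_refl i : sn_coef (1 - i) = - sn_coef i.
Proof. by rewrite /sn_coef odd_freq_refl mulNr sinh2N invrN. Qed.

Lemma dn_coefN i : dn_coef (- i) = dn_coef i.
Proof. by rewrite /dn_coef even_freqN mulNr cosh2N. Qed.

Definition decay_const : R := (1 - expR (- (2 * p)))^-1.

Lemma decay_const_ge1 : 1 <= decay_const.
Proof.
have e0 := expR_gt0 (- (2 * p)).
have e1 : expR (- (2 * p)) < 1 by rewrite expR_lt1 oppr_lt0 mulr_gt0.
by rewrite /decay_const invf_ge1 ?subr_gt0//; lra.
Qed.

Lemma cosh2V_le x : `|(cosh2 x)^-1| <= decay_const * expR (- `|x|).
Proof.
rewrite gtr0_norm ?invr_gt0 ?cosh2_gt0//.
apply: (@le_trans _ _ (expR (- `|x|))); last first.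
  by rewrite ler_peMl ?expR_ge0// decay_const_ge1.
rewrite expRN lef_pV2 ?posrE ?expR_gt0 ?cosh2_gt0// /cosh2.
have := expR_gt0 x; have := expR_gt0 (- x).
by have [?|?] := leP 0 x; [rewrite ger0_norm//|rewrite ltr0_norm//]; lra.
Qed.

Lemma cn_coef_le i : `|cn_coef i| <= decay_const * expR (- (p * `|odd_freq i|)).
Proof. by apply: le_trans (cosh2V_le _) _; rewrite normrM (gtr0_norm p0) (mulrC p). Qed.

Lemma dn_coef_le i : `|dn_coef i| <= decay_const * expR (- (p * `|even_freq i|)).
Proof. by apply: le_trans (cosh2V_le _) _; rewrite normrM (gtr0_norm p0) (mulrC p). Qed.

(** The odd frequencies stay away from 0, so that 2 sinh is bounded below there
    by a multiple of the exponential. *)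
Lemma sn_coef_le i : `|sn_coef i| <= decay_const * expR (- (p * `|odd_freq i|)).
Proof.
wlog i0 : i / 0 < i => [H|].
  have [?|ile0] := ltP 0 i; first exact: H.
  have : 0 < 1 - i by lia.
  by move/H; rewrite sn_coef_refl odd_freq_refl !normrN.
have f1 := odd_freq_norm_ge1 i; have f0 := odd_freq_gt0 i0.
have x0 : 0 < odd_freq i * p by rewrite mulr_gt0.
rewrite gtr0_norm ?invr_gt0 ?sinh2_gt0//.
have e0 := expR_gt0 (- (2 * p)).
have e1 : expR (- (2 * p)) < 1 by rewrite expR_lt1 oppr_lt0 mulr_gt0.
rewrite expRN /decay_const -invfM lef_pV2 ?posrE ?sinh2_gt0//; last first.
  by rewrite mulr_gt0 ?subr_gt0 ?expR_gt0.
rewrite (gtr0_norm f0) [p * _]mulrC /sinh2 mulrBl mul1r lerB// -expRD ler_expR.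
rewrite gtr0_norm// in f1.
have : 1 * p <= odd_freq i * p by rewrite ler_wpM2r// ltW.
by lra.
Qed.

Lemma zsummable_decay (a f : int -> R) : (forall i, `|i%:~R| <= `|f i|) ->
  (forall i, `|a i| <= decay_const * expR (- (p * `|f i|))) -> zsummable a.
Proof.
move=> fge ale; apply: (zsummable_le ale).
exact/zsummableZ/zsummable_expR.
Qed.

Lemma cn_coef_summable : zsummable cn_coef.
Proof. exact: zsummable_decay odd_freq_ge cn_coef_le. Qed.
Lemma sn_coef_summable : zsummable sn_coef.
Proof. exact: zsummable_decay odd_freq_ge sn_coef_le. Qed.
Lemma dn_coef_summable : zsummable dn_coef.
Proof. exact: zsummable_decay even_freq_ge dn_coef_le. Qed.

Let tanh_odd i : R := sinh2 (odd_freq i * p) / cosh2 (odd_freq i * p).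
Let coth_odd i : R := cosh2 (odd_freq i * p) / sinh2 (odd_freq i * p).

Lemma tanh_oddN i : tanh_odd (1 - i) = - tanh_odd i.
Proof. by rewrite /tanh_odd odd_freq_refl mulNr sinh2N cosh2N mulNr. Qed.

Lemma coth_oddN i : coth_odd (1 - i) = - coth_odd i.
Proof. by rewrite /coth_odd odd_freq_refl mulNr sinh2N cosh2N invrN mulrN. Qed.

Lemma tanh_odd_kink j : 0 < j -> `|tanh_odd j - 1| <= 2 * `|cn_coef j|.
Proof.
move=> j0; have x0 : 0 < odd_freq j * p by rewrite mulr_gt0 ?odd_freq_gt0.
have c0 := cosh2_gt0 (odd_freq j * p).
have -> : tanh_odd j - 1 = - (2 * expR (- (odd_freq j * p))) * cn_coef j.
  have c1 : cosh2 (odd_freq j * p) != 0 by rewrite gt_eqF.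
  by move: c1; rewrite /tanh_odd /cn_coef /sinh2 /cosh2 => c1; field.
rewrite normrM ler_wpM2r// normrN ger0_norm ?mulr_ge0 ?expR_ge0//.
by rewrite ler_piMr// expR_le1; lra.
Qed.

Lemma coth_odd_kink j : 0 < j -> `|coth_odd j - 1| <= 2 * `|sn_coef j|.
Proof.
move=> j0; have x0 : 0 < odd_freq j * p by rewrite mulr_gt0 ?odd_freq_gt0.
have s0 := sinh2_gt0 x0.
have -> : coth_odd j - 1 = (2 * expR (- (odd_freq j * p))) * sn_coef j.
  have c1 : sinh2 (odd_freq j * p) != 0 by rewrite gt_eqF.
  by move: c1; rewrite /coth_odd /sn_coef /sinh2 /cosh2 => c1; field.
rewrite normrM ler_wpM2r// ger0_norm ?mulr_ge0 ?expR_ge0//.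
by rewrite ler_piMr// expR_le1; lra.
Qed.

Lemma conv_summable (a b : int -> R) n : zsummable a -> zsummable b ->
  zsummable (fun m => a (n - m) * b m).
Proof.
move=> as_ bs; apply: (@zsummable_le _ _ (fun m => zsum (fun j => `|a j|) * `|b m|)).
  by move=> m; rewrite normrM ler_wpM2r//; exact: zsummable_bounded.
exact/zsummableZ/zsummable_norm.
Qed.

Let tanh_even i : R := sinh2 (even_freq i * p) / cosh2 (even_freq i * p).

Lemma tanh_evenN i : tanh_even (- i) = - tanh_even i.
Proof. by rewrite /tanh_even even_freqN mulNr sinh2N cosh2N mulNr. Qed.

Let cosh2n0 x : cosh2 x != 0. Proof. by rewrite gt_eqF ?cosh2_gt0. Qed.
Let sinh2n0 i : sinh2 (odd_freq i * p) != 0.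
Proof. by rewrite sinh2_eq0 mulf_neq0 ?odd_freq_neq0 ?gt_eqF. Qed.

(** As a function of n the sum is affine of slope 2 and odd with respect to the
    reflection n -> 1 - n, which determines it. *)
Lemma kink_sum_odd_even (U a : int -> R) : zsummable a ->
  (forall j, U (1 - j) = - U j) ->
  (forall j, 0 < j -> `|U j - 1| <= 2 * `|a j|) ->
  (forall n, zsummable (fun m => U (n - m) + tanh_even m)) ->
  forall n, zsum (fun m => U (n - m) + tanh_even m) = odd_freq n.
Proof.
move=> as_ Uodd Ua Us.
pose A n := zsum (fun m => U (n - m) + tanh_even m).
have AS n : A (n + 1) = A n + 2 by exact: zsum_kink_step as_ Uodd Ua Us.
have Arefl n : A (1 - n) = - A n.
  rewrite /A -zsumN// -(zsum_reflect 0 (zsummableN (Us n))).2.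
  apply: eq_zsum => m; rewrite sub0r tanh_evenN opprD !opprK -Uodd; congr (U _ + _); lia.
move=> n; rewrite -/(A n); rewrite (int_affine AS).
have := AS 0; have := Arefl 0; rewrite add0r subr0 => -> H.
have -> : A 0 = -1 by lra.
by rewrite /odd_freq intrB addrC.
Qed.

(** The reflection is now n -> 2 - n, and n = 1 is its fixed point. *)
Lemma kink_sum_odd_odd (U V a : int -> R) : zsummable a ->
  (forall j, U (1 - j) = - U j) -> (forall j, V (1 - j) = - V j) ->
  (forall j, 0 < j -> `|U j - 1| <= 2 * `|a j|) ->
  (forall n, zsummable (fun m => U (n - m) + V m)) ->
  forall n, zsum (fun m => U (n - m) + V m) = even_freq (n - 1).
Proof.
move=> as_ Uodd Vodd Ua Us.
pose A n := zsum (fun m => U (n - m) + V m).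
have AS n : A (n + 1) = A n + 2 by exact: zsum_kink_step as_ Uodd Ua Us.
have Arefl n : A (2 - n) = - A n.
  rewrite /A -zsumN// -(zsum_reflect 1 (zsummableN (Us n))).2.
  apply: eq_zsum => m; rewrite Vodd opprD !opprK -Uodd; congr (U _ + _); lia.
move=> n; rewrite -/(A n); rewrite (int_affine AS).
have := AS 0; have := Arefl 1; rewrite add0r (_ : 2 - 1 = 1 :> int)// => H1 H2.
have -> : A 0 = -2 by lra.
by rewrite /even_freq mulrBr mulr1 intrB addrC.
Qed.

(** As sinh (a + b) / (cosh a cosh b) = tanh a + tanh b, the convolution is a sum
    of kinks, up to a factor that depends on n alone. *)
Lemma conv_cn_dn n : zsum (fun m => cn_coef (n - m) * dn_coef m) =
  odd_freq n * sn_coef n / 2.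
Proof.
have E k m : tanh_odd (k - m) + tanh_even m =
    2 * sinh2 (odd_freq k * p) * (cn_coef (k - m) * dn_coef m).
  rewrite /tanh_odd /tanh_even -(odd_even_freqD k m) (mulrDl (odd_freq _)) sinh2D
    /cn_coef /dn_coef.
  by field; rewrite !cosh2n0.
have Us k : zsummable (fun m => tanh_odd (k - m) + tanh_even m).
  apply: eq_zsummable (fun m => esym (E k m)).
  by apply/zsummableZ/conv_summable; [exact: cn_coef_summable|exact: dn_coef_summable].
have := kink_sum_odd_even cn_coef_summable tanh_oddN tanh_odd_kink Us n.
under eq_zsum do rewrite E.
rewrite zsumZ; last by apply: conv_summable; [exact: cn_coef_summable|exact: dn_coef_summable].
by move=> <-; rewrite /sn_coef; field; rewrite sinh2n0.
Qed.

(** Likewise with cosh (a + b) / (sinh a cosh b) = coth a + tanh b. *)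
Lemma conv_sn_dn n : zsum (fun m => sn_coef (n - m) * dn_coef m) =
  odd_freq n * cn_coef n / 2.
Proof.
have E k m : coth_odd (k - m) + tanh_even m =
    2 * cosh2 (odd_freq k * p) * (sn_coef (k - m) * dn_coef m).
  rewrite /coth_odd /tanh_even -(odd_even_freqD k m) (mulrDl (odd_freq _)) cosh2D
    /sn_coef /dn_coef.
  by field; rewrite cosh2n0 sinh2n0.
have Us k : zsummable (fun m => coth_odd (k - m) + tanh_even m).
  apply: eq_zsummable (fun m => esym (E k m)).
  by apply/zsummableZ/conv_summable; [exact: sn_coef_summable|exact: dn_coef_summable].
have := kink_sum_odd_even sn_coef_summable coth_oddN coth_odd_kink Us n.
under eq_zsum do rewrite E.
rewrite zsumZ; last by apply: conv_summable; [exact: sn_coef_summable|exact: dn_coef_summable].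
by move=> <-; rewrite /cn_coef; field; rewrite cosh2n0.
Qed.

Lemma conv_sn_cn n : zsum (fun m => sn_coef (n - m) * cn_coef m) =
  even_freq (n - 1) * dn_coef (n - 1) / 2.
Proof.
have E k m : coth_odd (k - m) + tanh_odd m =
    2 * cosh2 (even_freq (k - 1) * p) * (sn_coef (k - m) * cn_coef m).
  rewrite /coth_odd /tanh_odd -(odd_odd_freqD k m) (mulrDl (odd_freq _)) cosh2D
    /sn_coef /cn_coef.
  by field; rewrite cosh2n0 sinh2n0.
have Us k : zsummable (fun m => coth_odd (k - m) + tanh_odd m).
  apply: eq_zsummable (fun m => esym (E k m)).
  by apply/zsummableZ/conv_summable; [exact: sn_coef_summable|exact: cn_coef_summable].
have := kink_sum_odd_odd sn_coef_summable coth_oddN tanh_oddN coth_odd_kink Us n.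
under eq_zsum do rewrite E.
rewrite zsumZ; last by apply: conv_summable; [exact: sn_coef_summable|exact: cn_coef_summable].
by move=> <-; rewrite /dn_coef; field; rewrite cosh2n0.
Qed.

End Coefficients.

(** * Trigonometric and hyperbolic mode series *)

Section Modes.
Variable R : realType.
Implicit Types (a b f g : int -> R) (x y : R) (X : R -> R).

(** What (cos, sin) and (cosh, sinh) have in common: eps is -1 or 1, and sg is the
    rate of growth. The hyperbolic series are the restrictions of the elliptic
    functions to the imaginary axis; treating both pairs at once replaces
    analytic continuation. *)
Record cosine_pair (E O : R -> R) (eps sg : R) : Prop := CosinePair {
  pairED : forall x y, E (x + y) = E x * E y + eps * (O x * O y);
  pairOD : forall x y, O (x + y) = O x * E y + E x * O y;
  pairEN : forall x, E (- x) = E x;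
  pairON : forall x, O (- x) = - O x;
  pairE0 : E 0 = 1;
  pairdE : forall x, is_derive x 1 E (eps * O x);
  pairdO : forall x, is_derive x 1 O (E x);
  pair_eps : `|eps| <= 1;
  pair_sg : 0 <= sg;
  pairE_le : forall x, `|E x| <= expR (sg * `|x|);
  pairO_le : forall x, `|O x| <= expR (sg * `|x|) }.

Lemma cos_sin_pair : cosine_pair cos sin (-1) 0.
Proof.
split.
- by move=> x y; rewrite cosD mulN1r.
- by move=> x y; rewrite sinD.
- exact: cosN.
- exact: sinN.
- exact: cos0.
- by move=> x; rewrite mulN1r; exact: is_derive_cos.
- by move=> x; exact: is_derive_sin.
- by rewrite normrN1.
- by [].
- by move=> x; rewrite mul0r expR0 cos_max.
- by move=> x; rewrite mul0r expR0 sin_max.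
Qed.

Lemma is_derive_expRN x : is_derive x 1 (fun y => expR (- y)) (- expR (- x)).
Proof.
rewrite (_ : (fun _ => _) = expR \o -%R)//.
by apply: is_derive_eq; rewrite mulrN1.
Qed.

Lemma cosh_sinh_pair :
  cosine_pair (fun x => cosh2 x / 2) (fun x => sinh2 x / 2) 1 1.
Proof.
have le x : 0 < expR x /\ 0 < expR (- x) /\ expR x <= expR `|x| /\ expR (- x) <= expR `|x|.
  by rewrite !expR_gt0 !ler_expR ler_norm -normrN ler_norm.
split.
- by move=> x y; rewrite mul1r; have := cosh2D x y => H; lra.
- by move=> x y; have := sinh2D x y => H; lra.
- by move=> x; rewrite cosh2N.
- by move=> x; rewrite sinh2N mulNr.
- by rewrite /cosh2 oppr0 expR0; lra.
- move=> x; rewrite (_ : (fun _ => _) = 2^-1 \*: (expR + (fun y => expR (- y)))).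
    have HN := is_derive_expRN x.
    by apply: is_derive_eq; rewrite mul1r /sinh2 scalerBr /GRing.scale /=; ring.
  by apply/funext => y; rewrite mulrC.
- move=> x; rewrite (_ : (fun _ => _) = 2^-1 \*: (expR - (fun y => expR (- y)))).
    have HN := is_derive_expRN x.
    by apply: is_derive_eq; rewrite /cosh2 opprK scalerDr /GRing.scale /=; ring.
  by apply/funext => y; rewrite mulrC.
- by rewrite normr1.
- by [].
- move=> x; have [? [? [? ?]]] := le x.
  by rewrite mul1r /cosh2 ler_norml; apply/andP; split; lra.
- move=> x; have [? [? [? ?]]] := le x.
  by rewrite mul1r /sinh2 ler_norml; apply/andP; split; lra.
Qed.

Definition mode_sum a f X x : R := zsum (fun i => a i * X (f i * x)).

Variable p : R.
Hypothesis p0 : 0 < p.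

Definition decays a f : Prop :=
  (forall i, `|i%:~R| <= `|f i|) /\
  (exists2 M, 0 <= M & forall i, `|a i| <= M * expR (- (p * `|f i|))).

Lemma decays_cn_coef : decays (cn_coef p) (@odd_freq R).
Proof.
split; first exact: odd_freq_ge; exists (decay_const p); last exact: cn_coef_le.
by apply: le_trans (decay_const_ge1 p0); rewrite ler01.
Qed.

Lemma decays_sn_coef : decays (sn_coef p) (@odd_freq R).
Proof.
split; first exact: odd_freq_ge; exists (decay_const p); last exact: sn_coef_le.
by apply: le_trans (decay_const_ge1 p0); rewrite ler01.
Qed.

Lemma decays_dn_coef : decays (dn_coef p) (@even_freq R).
Proof.
split; first exact: even_freq_ge; exists (decay_const p); last exact: dn_coef_le.
by apply: le_trans (decay_const_ge1 p0); rewrite ler01.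
Qed.

Variable (sg : R).
Hypothesis sg0 : 0 <= sg.

Definition grows X := forall x, `|X x| <= expR (sg * `|x|).

Lemma grow_summable a f x : decays a f -> sg * `|x| < p ->
  zsummable (fun i => `|a i| * expR (sg * `|f i * x|)).
Proof.
move=> [fge [M M0 aM]] xp.
have dl0 : 0 < p - sg * `|x| by rewrite subr_gt0.
apply: (@zsummable_le _ _ (fun i => M * expR (- ((p - sg * `|x|) * `|f i|)))); last first.
  exact/zsummableZ/zsummable_expR.
move=> i; rewrite ger0_norm; last by rewrite mulr_ge0 ?expR_ge0.
rewrite mulrBl opprB addrC expRD mulrA normrM.
rewrite (_ : sg * (`|f i| * `|x|) = sg * `|x| * `|f i|); last by ring.
by rewrite ler_wpM2r ?expR_ge0.
Qed.

Lemma mode_sum_summable a f X x : decays a f -> grows X -> sg * `|x| < p ->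
  zsummable (fun i => a i * X (f i * x)).
Proof.
move=> af Xg xp; apply: zsummable_le (grow_summable af xp) => i.
by rewrite normrM ler_wpM2l.
Qed.

(** The frequency brought down by a derivative costs an arbitrarily small part of
    the exponential decay. *)
Lemma mulr_expRN_le (dl t : R) : 0 < dl -> 0 <= t ->
  t * expR (- (dl * t)) <= 2 / dl * expR (- (dl / 2 * t)).
Proof.
move=> dl0 t0.
have -> : - (dl * t) = - (dl / 2 * t) + - (dl / 2 * t) by field.
rewrite expRD mulrA ler_wpM2r ?expR_ge0//.
rewrite -ler_pdivlMr ?expR_gt0// expRN invrK.
have H : dl / 2 * t <= expR (dl / 2 * t).
  by apply: le_trans (expR_ge1Dx _); rewrite lerDr.
rewrite -(ler_pM2l (_ : 0 < dl / 2)) ?divr_gt0//.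
apply: le_trans H _; set e := expR _.
by rewrite (_ : dl / 2 * _ = e)//; field; rewrite gt_eqF.
Qed.

(** A bound uniform in a neighbourhood of x, small enough to keep half of the
    margin p - sg |x|. *)
Lemma mode_sum_dominated a f X x : decays a f -> sg * `|x| < p -> grows X ->
  exists2 e, 0 < e & exists2 B, zsummable B &
    forall i y, `|y - x| < e -> sg * `|y| < p /\ `|a i * f i * X (f i * y)| <= B i.
Proof.
move=> [fge [M M0 aM]] xp Xg.
pose dl := (p - sg * `|x|) / 2.
have dl0 : 0 < dl by rewrite divr_gt0// subr_gt0.
(* The denominator sg + 1 avoids a division by zero when sg = 0. *)
exists (dl / (sg + 1)); first by rewrite divr_gt0// ltr_wpDl.
exists (fun i => M * (2 / dl * expR (- (dl / 2 * `|f i|)))).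
  by apply/zsummableZ/zsummableZ/zsummable_expR => //; rewrite divr_gt0.
move=> i y yx.
have sy : sg * `|y| <= p - dl.
  have : `|y| <= `|x| + dl / (sg + 1).
    rewrite -[y](subrK x) addrC; apply: le_trans (ler_normD _ _) _.
    by rewrite lerD2l ltW.
  move=> /(ler_wpM2l sg0) H; apply: le_trans H _; rewrite mulrDr.
  have : sg * (dl / (sg + 1)) <= dl.
    rewrite mulrA ler_pdivrMr ?ltr_wpDl// mulrC ler_wpM2l ?(ltW dl0)//.
    by rewrite lerDl.
  by rewrite /dl => ?; lra.
clearbody dl.
split; first by apply: le_lt_trans sy _; rewrite ltrBlDr ltrDl.
rewrite !normrM.
apply: (@le_trans _ _ (M * expR (- (p * `|f i|)) * `|f i| * expR (sg * `|y| * `|f i|))).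
  apply: ler_pM => //; first by rewrite ler_wpM2r.
  by apply: le_trans (Xg _) _; rewrite normrM ler_expR mulrCA mulrC -mulrA (mulrC `|y|).
rewrite [leLHS](_ : _ = M * (`|f i| * expR (- (p * `|f i|) + sg * `|y| * `|f i|))).
  rewrite ler_wpM2l//; apply: (le_trans _ (mulr_expRN_le dl0 (normr_ge0 (f i)))).
  by rewrite ler_wpM2l// ler_expR -!mulNr -mulrDl ler_wpM2r//; lra.
by rewrite expRD; ring.
Qed.

Lemma deriv_mode_sum_summable a f X x : decays a f -> grows X -> sg * `|x| < p ->
  zsummable (fun i => a i * f i * X (f i * x)).
Proof.
move=> af Xg xp; have [e e0 [B Bs Bdom]] := mode_sum_dominated af xp Xg.
apply: (zsummable_le _ Bs) => i.
by apply: (Bdom i x _).2; rewrite subrr normr0.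
Qed.

Lemma is_derive_mode_sum a f X Y c x : decays a f -> grows X -> grows Y ->
  `|c| <= 1 -> (forall y, is_derive y 1 X (c * Y y)) -> sg * `|x| < p ->
  is_derive x 1 (mode_sum a f X) (c * zsum (fun i => a i * f i * Y (f i * x))).
Proof.
move=> af Xg Yg c1 dX xp.
have [e e0 [B Bs Bdom]] := mode_sum_dominated af xp Yg.
rewrite -zsumZ; last exact: deriv_mode_sum_summable.
apply: (@zsum_is_derive _ (fun i y => a i * X (f i * y))
  (fun i y => c * (a i * f i * Y (f i * y))) B x e) => //.
- move=> i y _.
  rewrite (_ : (fun _ => _) = a i \*: (X \o ( *%R (f i)))); last by apply/funext.
  have dl : is_derive y 1 ( *%R (f i)) (f i).
    rewrite (_ : *%R _ = f i \*: id); last by apply/funext.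
    by apply: is_derive_eq; rewrite [_ *: 1]mulr1.
  have dXy := dX (f i * y).
  by apply: is_derive_eq; rewrite /GRing.scale /=; ring.
- move=> i y yx; rewrite normrM; apply: le_trans ((Bdom i y yx).2).
  by rewrite ler_piMl.
- move=> y yx; apply: mode_sum_summable => //.
  exact: (Bdom 0 y yx).1.
Qed.

(** The addition law of X splits the mode h n = f (n - m) + g m, and then the
    double sum factors. *)
Lemma mode_sum_convolution a f b g h X (E1 O1 E2 O2 : R -> R) x :
  decays a f -> decays b g -> sg * `|x| < p ->
  grows X -> grows E1 -> grows O1 ->
  (forall n m, h n = f (n - m) + g m) ->
  (forall y z, X (y + z) = E1 y * E2 z + O1 y * O2 z) ->
  grows E2 -> grows O2 ->
  zsum (fun n => zsum (fun m => a (n - m) * b m) * X (h n * x)) =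
  mode_sum a f E1 x * mode_sum b g E2 x + mode_sum a f O1 x * mode_sum b g O2 x.
Proof.
move=> af bg xp Xg E1g O1g hfg XD E2g O2g.
pose A m := b m * expR (sg * `|g m * x|).
pose B j := a j * expR (sg * `|f j * x|).
have exps (y : R) : `|expR y| = expR y by rewrite ger0_norm ?expR_ge0.
have As : zsummable A.
  by apply: zsummable_norm_le (grow_summable bg xp) => i; rewrite !normrM !exps normr_id.
have Bs : zsummable B.
  by apply: zsummable_norm_le (grow_summable af xp) => i; rewrite !normrM !exps normr_id.
have abs_ n : zsummable (fun m => a (n - m) * b m).
  have aM : zsummable a.
    case: af => fge [M M0 aM]; apply: (zsummable_le aM).
    exact/zsummableZ/zsummable_expR.
  have bM : zsummable b.
    case: bg => gge [M M0 bM]; apply: (zsummable_le bM).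
    exact/zsummableZ/zsummable_expR.
  exact: conv_summable.
pose F m n := a (n - m) * b m * X (h n * x).
have -> : zsum (fun n => zsum (fun m => a (n - m) * b m) * X (h n * x)) =
    zsum (fun n => zsum (F^~ n)).
  apply: eq_zsum => n; rewrite mulrC -zsumZ//.
  by apply: eq_zsum => m; rewrite mulrC.
rewrite -(@zsum_exchange _ F A B)//; last first.
  move=> m n; rewrite /F /A /B !normrM !exps.
  rewrite mulrACA (mulrC `|b m|) ler_wpM2l ?mulr_ge0//.
  apply: le_trans (Xg _) _; rewrite -expRD ler_expR -mulrDr ler_wpM2l//.
  by rewrite (hfg n m) -!normrM mulrDl [leRHS]addrC; exact: ler_normD.
have aE1 := mode_sum_summable af E1g xp.
have aO1 := mode_sum_summable af O1g xp.
have bE2 := mode_sum_summable bg E2g xp.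
have bO2 := mode_sum_summable bg O2g xp.
have -> : zsum (fun m => zsum (F m)) =
   zsum (fun m => mode_sum a f E1 x * (b m * E2 (g m * x))
                  + mode_sum a f O1 x * (b m * O2 (g m * x))).
  apply: eq_zsum => m.
  have [s1 z1] := zsum_shift (- m) aE1.
  have [s2 z2] := zsum_shift (- m) aO1.
  rewrite /mode_sum -z1 -z2 2!(mulrC (zsum _)) -!zsumZ// -zsumD; [|exact: zsummableZ..].
  by apply: eq_zsum => n; rewrite /F (hfg n m) mulrDl XD; ring.
by rewrite zsumD ?zsumZ//; exact: zsummableZ.
Qed.

End Modes.

(** * The differential system of the three series *)

Section JacobiSystem.
Variable R : realType.
Implicit Types (x y : R).
Variable p : R.
Hypothesis p0 : 0 < p.

Definition cn_series (E : R -> R) x : R := mode_sum (cn_coef p) (@odd_freq R) E x.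
Definition sn_series (O : R -> R) x : R := mode_sum (sn_coef p) (@odd_freq R) O x.
Definition dn_series (E : R -> R) x : R := mode_sum (dn_coef p) (@even_freq R) E x.
Definition cn_sum : R := zsum (cn_coef p).
Definition dn_sum : R := zsum (dn_coef p).

Lemma cn_sum_gt0 : 0 < cn_sum.
Proof.
have c0 i : 0 < cn_coef p i by rewrite invr_gt0 cosh2_gt0.
by apply: (@zsum_gt0 _ _ 0) => [j||]; [exact: ltW|exact: c0|exact: cn_coef_summable].
Qed.

Lemma dn_sum_gt0 : 0 < dn_sum.
Proof.
have d0 i : 0 < dn_coef p i by rewrite invr_gt0 cosh2_gt0.
by apply: (@zsum_gt0 _ _ 0) => [j||]; [exact: ltW|exact: d0|exact: dn_coef_summable].
Qed.

Variables (E O : R -> R) (eps sg : R).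
Hypothesis EO : cosine_pair E O eps sg.

Let sg0 : 0 <= sg. Proof. exact: pair_sg EO. Qed.
Let Eg : grows sg E. Proof. exact: pairE_le EO. Qed.
Let Og : grows sg O. Proof. exact: pairO_le EO. Qed.
Let dcc := decays_cn_coef p0.
Let dsc := decays_sn_coef p0.
Let ddc := decays_dn_coef p0.

Lemma pairO0 : O 0 = 0.
Proof. by have := pairON EO 0; rewrite oppr0 => H; lra. Qed.

Lemma cn_series0 : cn_series E 0 = cn_sum.
Proof. by apply: eq_zsum => i; rewrite mulr0 (pairE0 EO) mulr1. Qed.

Lemma dn_series0 : dn_series E 0 = dn_sum.
Proof. by apply: eq_zsum => i; rewrite mulr0 (pairE0 EO) mulr1. Qed.

Lemma sn_series0 : sn_series O 0 = 0.
Proof. by rewrite -[RHS](zsum0 R); apply: eq_zsum => i; rewrite mulr0 pairO0 mulr0. Qed.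

Let half_eq (y z : R) : 2^-1 * y = z -> y = 2 * z. Proof. by move=> <-; lra. Qed.

Let self_opp_eq0 (y : R) : y = - y -> y = 0. Proof. by move=> H; lra. Qed.

(** The parities of the coefficients and of the modes do not match. *)
Lemma cn_series_odd0 x : sg * `|x| < p -> mode_sum (cn_coef p) (@odd_freq R) O x = 0.
Proof.
move=> xp; apply: self_opp_eq0; have H := mode_sum_summable dcc Og xp.
rewrite /mode_sum -zsumN// -{1}(zsum_reflect 1 H).2; apply: eq_zsum => i.
by rewrite cn_coef_refl odd_freq_refl mulNr (pairON EO) mulrN.
Qed.

Lemma dn_series_odd0 x : sg * `|x| < p -> mode_sum (dn_coef p) (@even_freq R) O x = 0.
Proof.
move=> xp; apply: self_opp_eq0; have H := mode_sum_summable ddc Og xp.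
rewrite /mode_sum -zsumN// -{1}(zsum_reflect 0 H).2; apply: eq_zsum => i.
by rewrite sub0r dn_coefN even_freqN mulNr (pairON EO) mulrN.
Qed.

Let epsO_grows : grows sg (fun x => eps * O x).
Proof.
move=> x; rewrite normrM; apply: le_trans (Og x).
by rewrite ler_piMl// (pair_eps EO).
Qed.

(** Differentiation multiplies a coefficient by its frequency, which makes it
    twice the convolution of the two other families; the convolution is the
    product of their series, the mixed terms being zero by parity. *)
Lemma is_derive_sn_series x : sg * `|x| < p ->
  is_derive x 1 (sn_series O) (2 * (cn_series E x * dn_series E x)).
Proof.
move=> xp; apply: is_derive_eq.
  apply: (@is_derive_mode_sum _ p sg sg0 _ _ _ E 1) => //; first by rewrite normr1.
  by move=> y; rewrite mul1r; exact: pairdO EO _.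
have := mode_sum_convolution p0 sg0 (h := @odd_freq R) (X := E)
  (E1 := E) (O1 := fun x => eps * O x) (E2 := E) (O2 := O) dcc ddc xp Eg Eg epsO_grows.
rewrite (dn_series_odd0 xp) mulr0 addr0 mul1r => <- //; first last.
- by move=> y z; rewrite (pairED EO); ring.
- by move=> n m; rewrite odd_even_freqD.
apply: half_eq; rewrite -zsumZ; last exact: (deriv_mode_sum_summable sg0 dsc Eg xp).
by apply: eq_zsum => n; rewrite conv_cn_dn//; ring.
Qed.

Lemma is_derive_cn_series x : sg * `|x| < p ->
  is_derive x 1 (cn_series E) (2 * eps * (sn_series O x * dn_series E x)).
Proof.
move=> xp; apply: is_derive_eq.
  apply: (@is_derive_mode_sum _ p sg sg0 _ _ _ O eps) => //; first exact: pair_eps EO.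
  by move=> y; exact: pairdE EO _.
have := mode_sum_convolution p0 sg0 (h := @odd_freq R) (X := O)
  (E1 := O) (O1 := E) (E2 := E) (O2 := O) dsc ddc xp Og Og Eg.
rewrite (dn_series_odd0 xp) mulr0 addr0 => <- //; first last.
- by move=> y z; rewrite (pairOD EO).
- by move=> n m; rewrite odd_even_freqD.
rewrite (mulrC 2) -mulrA; congr (_ * _).
apply: half_eq; rewrite -zsumZ; last exact: (deriv_mode_sum_summable sg0 dcc Og xp).
by apply: eq_zsum => n; rewrite conv_sn_dn//; ring.
Qed.

Lemma is_derive_dn_series x : sg * `|x| < p ->
  is_derive x 1 (dn_series E) (2 * eps * (sn_series O x * cn_series E x)).
Proof.
move=> xp; apply: is_derive_eq.
  apply: (@is_derive_mode_sum _ p sg sg0 _ _ _ O eps) => //; first exact: pair_eps EO.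
  by move=> y; exact: pairdE EO _.
have := mode_sum_convolution p0 sg0 (h := fun n => @even_freq R (n - 1)) (X := O)
  (E1 := O) (O1 := E) (E2 := E) (O2 := O) dsc dcc xp Og Og Eg.
rewrite (cn_series_odd0 xp) mulr0 addr0 => <- //; first last.
- by move=> y z; rewrite (pairOD EO).
- by move=> n m; rewrite odd_odd_freqD.
rewrite (mulrC 2) -mulrA; congr (_ * _).
have H := deriv_mode_sum_summable sg0 ddc Og xp.
rewrite -(zsum_shift (-1) H).2.
apply: half_eq; rewrite -zsumZ; last exact: (zsum_shift (-1) H).1.
by apply: eq_zsum => n; rewrite conv_sn_cn//; ring.
Qed.

Lemma const_on_ball (f : R -> R) x :
  (forall y, `|y| <= `|x| -> is_derive y 1 f 0) -> f x = f 0.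
Proof.
move=> df; have [|c _] := @MVT_ball _ f (fun=> 0) 0 x.
  by move=> z; rewrite !subr0; exact: df.
by rewrite mul0r => /eqP; rewrite subr_eq0 => /eqP.
Qed.

Let le_dom x y : sg * `|x| < p -> `|y| <= `|x| -> sg * `|y| < p.
Proof. by move=> xp yx; apply: le_lt_trans xp; rewrite ler_wpM2l. Qed.

(** A first integral of the differential system. *)
Lemma cn_series2 x : sg * `|x| < p -> cn_series E x ^+ 2 = cn_sum ^+ 2 + eps * sn_series O x ^+ 2.
Proof.
move=> xp; pose f y := cn_series E y ^+ 2 - eps * sn_series O y ^+ 2.
suff : f x = f 0.
  by rewrite /f cn_series0 sn_series0 expr0n mulr0 subr0 => <-; rewrite subrK.
apply: const_on_ball => y /(le_dom xp) yp.
have dC := is_derive_cn_series yp; have dS := is_derive_sn_series yp.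
rewrite (_ : f = cn_series E ^+ 2 - eps \*: (sn_series O ^+ 2)); last by apply/funext.
by apply: is_derive_eq; rewrite /GRing.scale /=; ring.
Qed.

Lemma dn_series2 x : sg * `|x| < p -> dn_series E x ^+ 2 = dn_sum ^+ 2 + eps * sn_series O x ^+ 2.
Proof.
move=> xp; pose f y := dn_series E y ^+ 2 - eps * sn_series O y ^+ 2.
suff : f x = f 0.
  by rewrite /f dn_series0 sn_series0 expr0n mulr0 subr0 => <-; rewrite subrK.
apply: const_on_ball => y /(le_dom xp) yp.
have dC := is_derive_dn_series yp; have dS := is_derive_sn_series yp.
rewrite (_ : f = dn_series E ^+ 2 - eps \*: (sn_series O ^+ 2)); last by apply/funext.
by apply: is_derive_eq; rewrite /GRing.scale /=; ring.
Qed.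

End JacobiSystem.

(** * The elliptic integral and its inversion *)

Section OrientedIntegral.
Variable R : realType.
Notation mu := (@lebesgue_measure R).

(** Near x the oriented integral differs by a constant from an integral with a
    fixed lower bound to the left of both x and 0. *)
Lemma is_derive_oriented_integral (f : R -> R) (x : R) : continuous f ->
  is_derive x 1 (fun y => \int[mu]_(t in `[0, y]) f t - \int[mu]_(t in `[y, 0]) f t)
    (f x).
Proof.
move=> fC.
have fint a b : mu.-integrable `[a, b] (EFin \o f).
  apply: continuous_compact_integrable; first exact: segment_compact.
  exact: continuous_subspaceT.
have fint' a b : mu.-integrable `]a, b] (EFin \o f).
  by apply: integrableS (fint a b) => //; exact: subset_itv_oc_cc.
pose a : R := - (`|x| + 1).
pose P (y : R) : R := \int[mu]_(t in `[a, y]) f t.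
have ax : a < x by rewrite /a ltrNl ltr_pwDr// -normrN ler_norm.
have a0 : a < 0 by rewrite /a oppr_lt0 ltr_wpDl.
have [dP dPE] : derivable P x 1 /\ derive1 P x = f x.
  apply: (@continuous_FTC1_closed _ f a x (x + 1)) => //; first by rewrite ltrDl.
  exact: fC.
have dP' : is_derive x 1 (P - cst (P 0)) (f x).
  have H : is_derive x 1 P (f x) by apply: DeriveDef => //; rewrite -derive1E.
  by apply: is_derive_eq; rewrite subr0.
apply: near_eq_is_derive dP'; near=> y.
have ay : a < y by near: y; exact: lt_nbhsr.
rewrite /= /P; have [y0|y0] := leP 0 y.
  have -> : \int[mu]_(t in `[y, 0]) f t = 0.
    move: y0; rewrite le_eqVlt => /predU1P[<-|y0].
      by rewrite set_itv1 Rintegral_set1.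
    by rewrite set_itv_ge ?Rintegral_set0// bnd_simp -ltNge.
  rewrite subr0 -(@Rintegral_itv_obnd_cbnd _ 0)//.
  by apply: Rintegral_itvB; rewrite ?bnd_simp// ltW.
have -> : \int[mu]_(t in `[0, y]) f t = 0.
  by rewrite set_itv_ge ?Rintegral_set0// bnd_simp -ltNge.
rewrite sub0r -(@Rintegral_itv_obnd_cbnd _ y)//.
rewrite -[LHS]opprB; congr (- _).
by apply: Rintegral_itvB; rewrite ?bnd_simp// ltW.
Unshelve. all: by end_near. Qed.

End OrientedIntegral.

Section EllipticIntegral.
Variable R : realType.
Implicit Types (k m phi u x y t : R).

Lemma modulus_gt0 k t : k ^+ 2 < 1 -> 0 < 1 - k ^+ 2 * sin t ^+ 2.
Proof.
move=> k1; rewrite subr_gt0; apply: le_lt_trans k1.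
by rewrite ler_piMr ?sqr_ge0// sin2cos2 lerBlDr lerDl sqr_ge0.
Qed.

Lemma elliptic_integrand_gt0 k t : k ^+ 2 < 1 -> 0 < elliptic_integrand k t.
Proof. by move=> k1; rewrite invr_gt0 sqrtr_gt0 modulus_gt0. Qed.

Lemma continuous_elliptic_integrand k : k ^+ 2 < 1 -> continuous (elliptic_integrand k).
Proof.
move=> k1 t; apply: cvgV; first by rewrite gt_eqF// sqrtr_gt0 modulus_gt0.
apply: continuous_comp; last exact: sqrt_continuous.
apply: cvgB; first exact: cvg_cst.
apply: cvgM; first exact: cvg_cst.
by apply: cvgM; exact: continuous_sin.
Qed.

Lemma is_derive_ellipticF k phi : k ^+ 2 < 1 ->
  is_derive phi 1 (ellipticF k) (elliptic_integrand k phi).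
Proof.
move=> k1; apply: is_derive_oriented_integral; exact: continuous_elliptic_integrand.
Qed.

Lemma continuous_ellipticF k : k ^+ 2 < 1 -> continuous (ellipticF k).
Proof.
move=> k1 x; apply: differentiable_continuous; apply/derivable1_diffP.
by have [] := is_derive_ellipticF x k1.
Qed.

Lemma ellipticF0 k : ellipticF k 0 = 0.
Proof. by rewrite /ellipticF subrr. Qed.

Lemma lt_ellipticF k : k ^+ 2 < 1 -> {homo ellipticF k : x y / x < y}.
Proof.
move=> k1 x y xy; rewrite -subr_gt0.
have [c _ ->] := @MVT_ball _ (ellipticF k) (elliptic_integrand k) x y
  (fun z _ => is_derive_ellipticF z k1).
by rewrite mulr_gt0 ?subr_gt0// elliptic_integrand_gt0.
Qed.

Lemma ellipticF_inj k : k ^+ 2 < 1 -> injective (ellipticF k).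
Proof.
move=> k1 x y Fxy; have [/(lt_ellipticF k1)|/(lt_ellipticF k1)|//] := ltgtP x y;
  by rewrite Fxy ltxx.
Qed.

(** F o phi has the constant derivative lam. *)
Lemma ellipticF_flow k lam (phi : R -> R) x : k ^+ 2 < 1 -> phi 0 = 0 ->
  (forall y, `|y| <= `|x| ->
    is_derive y 1 phi (lam * Num.sqrt (1 - k ^+ 2 * sin (phi y) ^+ 2))) ->
  ellipticF k (phi x) = lam * x.
Proof.
move=> k1 phi0 dphi.
suff : ellipticF k (phi x) - lam * x = ellipticF k (phi 0) - lam * 0.
  by rewrite phi0 ellipticF0 mulr0 subr0 => /eqP; rewrite subr_eq0 => /eqP.
apply: (@const_on_ball _ (fun y => ellipticF k (phi y) - lam * y)) => y yx.
have dp := dphi y yx.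
have dF := is_derive_ellipticF (phi y) k1.
rewrite (_ : (fun _ => _) = (ellipticF k \o phi) - lam \*: id); last by apply/funext.
apply: is_derive_eq; rewrite /elliptic_integrand /GRing.scale /= mulr1.
have s0 : Num.sqrt (1 - k ^+ 2 * sin (phi y) ^+ 2) != 0.
  by rewrite gt_eqF// sqrtr_gt0 modulus_gt0.
by field.
Qed.

Lemma jacobi_amE k u phi : k ^+ 2 < 1 -> ellipticF k phi = u -> jacobi_am k u = phi.
Proof.
move=> k1 Fu; apply: xget_unique => //= psi Fpsi.
by apply: (ellipticF_inj k1); rewrite Fu.
Qed.

Lemma ellipticK_gt0 k : k ^+ 2 < 1 -> 0 < ellipticK k.
Proof.
move=> k1; rewrite -(ellipticF0 k); apply: lt_ellipticF => //.
by rewrite divr_gt0// pi_gt0.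
Qed.

(** The mean value theorem for the difference of the two incomplete integrals
    yields a point inside ]0, pi/2[, where the integrands differ strictly. *)
Lemma lt_ellipticK k m : 0 <= k -> k < m -> m < 1 -> ellipticK k < ellipticK m.
Proof.
move=> k0 km m1.
have m21 : m ^+ 2 < 1 by rewrite expr_lt1//; lra.
have k2m2 : k ^+ 2 < m ^+ 2 by rewrite ltr_pXn2r ?nnegrE//; lra.
have k21 := lt_trans k2m2 m21.
have pi2 : 0 < pi / 2 :> R by rewrite divr_gt0 ?pi_gt0.
rewrite -subr_gt0.
pose G := ellipticF m - ellipticF k.
have dG y : is_derive y 1 G (elliptic_integrand m y - elliptic_integrand k y).
  have d1 := is_derive_ellipticF y k21; have d2 := is_derive_ellipticF y m21.
  exact: is_deriveB.
have : G (pi / 2) - G 0 = ellipticK m - ellipticK k.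
  by rewrite /G !fctE /= !ellipticF0 !subr0.
have [|c cI ->] := @MVT _ G _ 0 (pi / 2) pi2 (fun z _ => dG z).
  apply: derivable_within_continuous => z _; by have [] := dG z.
move=> <-; rewrite mulr_gt0 ?subr0// subr_gt0.
rewrite ltf_pV2 ?posrE ?sqrtr_gt0 ?modulus_gt0//.
rewrite ltr_sqrt ?modulus_gt0// ltrD2l ltrN2 ltr_pM2r//.
rewrite exprn_gt0// sin_gt0_pi//; move: cI; rewrite in_itv /= => /andP[-> cpi].
by rewrite (lt_le_trans cpi)// ler_pdivrMr// ler_peMr ?pi_ge0// ler1n.
Qed.

End EllipticIntegral.

(** * The circular series parametrize the Jacobi functions *)

Section Circular.
Variable R : realType.
Implicit Types (x y : R).

Lemma sin_int_pi (i : int) : sin (i%:~R * pi) = 0 :> R.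
Proof.
have H n : sin (n%:R * pi) = 0 :> R.
  elim: n => [|n IH]; first by rewrite mul0r sin0.
  by rewrite -addn1 natrD mulrDl mul1r sinDpi IH oppr0.
by case: i => n; [exact: H|rewrite NegzE intrN mulNr sinN H oppr0].
Qed.

Lemma cos_even_freq_pi (i : int) : cos (even_freq R i * pi) = 1.
Proof.
rewrite (_ : even_freq R i * pi = (i%:~R * pi) *+ 2);
  last by rewrite /even_freq intrM mulr2n; ring.
by rewrite cos_mulr2n cos2sin2 sin_int_pi expr0n subr0; lra.
Qed.

Lemma cos_odd_freq_pi (i : int) : cos (odd_freq R i * pi) = -1.
Proof.
rewrite (_ : odd_freq R i * pi = even_freq R i * pi - pi);
  last by rewrite /odd_freq /even_freq intrB; ring.
by rewrite cosB cos_even_freq_pi cospi sinpi mulr0 addr0 mul1r.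
Qed.

Lemma sin_even_freq_pihalf (i : int) : sin (even_freq R i * (pi / 2)) = 0.
Proof.
rewrite (_ : even_freq R i * (pi / 2) = i%:~R * pi) ?sin_int_pi//.
by rewrite /even_freq intrM; field.
Qed.

Lemma series_delta n : series (zpair (fun i : int => (i == 0)%:R : R)) n.+1 = 1.
Proof.
elim: n => [|n IH]; first by rewrite /series /= big_nat1 /zpair /= addr0.
by rewrite seriesSr IH /zpair /= !addr0.
Qed.

Lemma zsum_delta : zsummable (fun i : int => (i == 0)%:R : R) /\
  zsum (fun i : int => (i == 0)%:R : R) = 1.
Proof.
have H : series (zpair (fun i : int => (i == 0)%:R : R)) @ \oo --> (1 : R).
  rewrite -(cvg_shiftS (series _)).
  by under eq_fun do rewrite series_delta; exact: cvg_cst.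
split; last exact: zsum_unique.
rewrite /zsummable; under [fun i => _]eq_fun do rewrite normr_nat.
by apply/cvg_ex; exists 1.
Qed.

Variable p : R.
Hypothesis p0 : 0 < p.

Notation C := (cn_series p cos).
Notation S := (sn_series p sin).
Notation D := (dn_series p cos).
Notation C0 := (cn_sum p).
Notation D0 := (dn_sum p).

Let dom x : 0 * `|x| < p. Proof. by rewrite mul0r. Qed.
Let CS := @cos_sin_pair R.

Lemma circular_dcn x : is_derive x 1 C (- 2 * (S x * D x)).
Proof. by apply: is_derive_eq (is_derive_cn_series p0 CS (dom x)) _; ring. Qed.
Lemma circular_dsn x : is_derive x 1 S (2 * (C x * D x)).
Proof. exact: (is_derive_sn_series p0 CS (dom x)). Qed.
Lemma circular_ddn x : is_derive x 1 D (- 2 * (S x * C x)).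
Proof. by apply: is_derive_eq (is_derive_dn_series p0 CS (dom x)) _; ring. Qed.

Lemma circular_cn2 x : C x ^+ 2 = C0 ^+ 2 - S x ^+ 2.
Proof. by rewrite (cn_series2 p0 CS (dom x)); ring. Qed.
Lemma circular_dn2 x : D x ^+ 2 = D0 ^+ 2 - S x ^+ 2.
Proof. by rewrite (dn_series2 p0 CS (dom x)); ring. Qed.

Let T x := mode_sum (fun i => sn_coef p i / odd_freq R i) (@odd_freq R) cos x.

Let decays_T : decays p (fun i => sn_coef p i / odd_freq R i) (@odd_freq R).
Proof.
split; first exact: odd_freq_ge.
have [_ [M M0 sM]] := decays_sn_coef p0; exists M => // i.
apply: le_trans (sM i); rewrite normrM (normfV (odd_freq R i)) ler_piMr// invf_le1.
  exact: odd_freq_norm_ge1.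
by rewrite normr_gt0 odd_freq_neq0.
Qed.

Let dT x : is_derive x 1 T (- S x).
Proof.
apply: is_derive_eq.
  apply: (@is_derive_mode_sum _ p 0 (lexx 0) _ _ _ sin (-1)).
  - exact: decays_T.
  - exact: pairE_le CS.
  - exact: pairO_le CS.
  - exact: pair_eps CS.
  - exact: pairdE CS.
  - exact: dom.
rewrite mulN1r; congr (- _); apply: eq_zsum => i.
by rewrite divfK// odd_freq_neq0.
Qed.

Let Cpi : C pi = - C0.
Proof.
rewrite /cn_sum -zsumN; last exact: cn_coef_summable.
by apply: eq_zsum => i; rewrite cos_odd_freq_pi mulrN1.
Qed.

Let Dpi : D pi = D0.
Proof. by apply: eq_zsum => i; rewrite cos_even_freq_pi mulr1. Qed.

(** Both functions satisfy a homogeneous linear equation of the first order,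
    (dn - cn)' = 2 sn (dn - cn) and (dn + cn)' = - 2 sn (dn + cn), hence keep the
    sign that they have at pi, where cn is - cn_sum, and at 0 respectively. *)
Lemma dn_dominates_cn x : 0 < D x - C x /\ 0 < D x + C x.
Proof.
pose f y := (D y - C y) * expR (2 * T y).
pose g y := (D y + C y) * expR (- 2 * T y).
have cC0 := cn_sum_gt0 p0; have cD0 := dn_sum_gt0 p0.
have dE (c : R) y : is_derive y 1 (fun z => expR (c * T z)) (- c * S y * expR (c * T y)).
  rewrite (_ : (fun _ => _) = expR \o (c \*: T)); last by apply/funext.
  have := dT y => ?; apply: is_derive_eq; rewrite /GRing.scale /=; ring.
have fE y : f y = f pi.
  apply: is_derive_0_is_cst => {}y.
  rewrite (_ : f = (D - C) * (fun z => expR (2 * T z))); last by apply/funext.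
  have := dE 2 y; have := circular_dcn y; have := circular_ddn y => ? ? ?.
  by apply: is_derive_eq; rewrite /GRing.scale /= !fctE; ring.
have gE y : g y = g 0.
  apply: is_derive_0_is_cst => {}y.
  rewrite (_ : g = (D + C) * (fun z => expR (- 2 * T z))); last by apply/funext.
  have := dE (-2) y; have := circular_dcn y; have := circular_ddn y => ? ? ?.
  by apply: is_derive_eq; rewrite /GRing.scale /= !fctE; ring.
have := fE x; have := gE x; rewrite /f /g Cpi Dpi (cn_series0 p CS) (dn_series0 p CS) => Hg Hf.
split.
  by rewrite -(pmulr_lgt0 _ (expR_gt0 (2 * T x))) Hf mulr_gt0 ?expR_gt0// opprK addr_gt0.
by rewrite -(pmulr_lgt0 _ (expR_gt0 (- 2 * T x))) Hg mulr_gt0 ?expR_gt0// addr_gt0.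
Qed.

Lemma dn_series_gt0 x : 0 < D x.
Proof. by have [? ?] := dn_dominates_cn x; lra. Qed.

(** In terms of theta constants of nome exp (- 2 p), this is theta_2^2 / theta_3^2. *)
Definition series_modulus : R := C0 / D0.

Lemma series_modulus_gt0 : 0 < series_modulus.
Proof. by rewrite divr_gt0 ?(cn_sum_gt0 p0) ?(dn_sum_gt0 p0). Qed.

Lemma series_modulus_lt1 : series_modulus < 1.
Proof.
rewrite ltr_pdivrMr ?(dn_sum_gt0 p0)// mul1r.
by have [+ _] := dn_dominates_cn 0; rewrite (cn_series0 p CS) (dn_series0 p CS) subr_gt0.
Qed.

Lemma series_modulus2_lt1 : series_modulus ^+ 2 < 1.
Proof. by rewrite expr_lt1// ?series_modulus_lt1// ltW// series_modulus_gt0. Qed.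

(** The primitive of 2 dn. Its constant Fourier coefficient, equal to 1, gives x;
    the division by zero at i = 0 drops that coefficient from the series. *)
Definition amplitude x : R :=
  x + mode_sum (fun i => 2 * dn_coef p i / even_freq R i) (@even_freq R) sin x.

Let decays_amplitude : decays p (fun i => 2 * dn_coef p i / even_freq R i) (@even_freq R).
Proof.
split; first exact: even_freq_ge.
have [_ [M M0 dM]] := decays_dn_coef p0; exists (2 * M) => [|i]; first by rewrite mulr_ge0.
have [->|i0] := eqVneq i 0.
  by rewrite /even_freq mulr0 invr0 mulr0 normr0 !mulr_ge0// expR_ge0.
rewrite -!mulrA normrM ger0_norm// ler_pM2l//.
apply: le_trans (dM i); rewrite normrM (normfV (even_freq R i)) ler_piMr// invf_le1.
  rewrite /even_freq -intr_norm -[1]/(1%:~R) ler_int; lia.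
rewrite normr_gt0 /even_freq intr_eq0; lia.
Qed.

Lemma is_derive_amplitude x : is_derive x 1 amplitude (2 * D x).
Proof.
rewrite (_ : amplitude =
  id + mode_sum (fun i => 2 * dn_coef p i / even_freq R i) (@even_freq R) sin); last by [].
have := @is_derive_mode_sum _ p 0 (lexx 0) _ _ sin cos 1 x decays_amplitude
  (pairO_le CS) (pairE_le CS).
rewrite normr1 lexx => /(_ isT) => H.
have {H} := H _ (dom x) => H.
have {H} := H _ => H.
apply: is_derive_eq; first apply: is_deriveD.
  by apply: H => y; rewrite mul1r; exact: pairdO CS y.
rewrite mul1r.
have [ds dE] := zsum_delta.
have Ds := mode_sum_summable (decays_dn_coef p0) (pairE_le CS) (dom x).
rewrite -[X in X + _]dE -zsumD//.
  rewrite /dn_series /mode_sum -zsumZ//; apply: eq_zsum => i.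
  have [->|i0] := eqVneq i 0.
    have fe0 : even_freq R 0 = 0 by rewrite /even_freq mulr0.
    by rewrite /dn_coef fe0 !mul0r cos0 /cosh2 oppr0 expR0 mulr0 mul0r addr0 mulr1
      divff// pnatr_eq0.
  rewrite add0r divfK ?mulrA//.
  rewrite /even_freq intr_eq0; lia.
exact: (deriv_mode_sum_summable (lexx 0) decays_amplitude (pairE_le CS) (dom x)).
Qed.

Lemma amplitude0 : amplitude 0 = 0.
Proof.
rewrite /amplitude add0r -[RHS](zsum0 R); apply: eq_zsum => i.
by rewrite mulr0 sin0 mulr0.
Qed.

Lemma amplitude_pihalf : amplitude (pi / 2) = pi / 2.
Proof.
rewrite /amplitude -[RHS]addr0 -[X in _ = _ + X](zsum0 R); congr (_ + _).
by apply: eq_zsum => i; rewrite sin_even_freq_pihalf mulr0.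
Qed.

(** (cn, sn) and (cos, sin) of the amplitude rotate at the same speed 2 dn, so that
    their inner product is constant; both vectors having a constant length, they
    stay parallel. *)
Lemma cn_sn_amplitude x : C x = C0 * cos (amplitude x) /\ S x = C0 * sin (amplitude x).
Proof.
pose f y := C y * cos (amplitude y) + S y * sin (amplitude y).
have fE : f x = C0.
  have -> : f x = f 0.
    apply: is_derive_0_is_cst => y.
    rewrite (_ : f = C * (cos \o amplitude) + S * (sin \o amplitude)); last by apply/funext.
    have := circular_dcn y; have := circular_dsn y; have := is_derive_amplitude y => ? ? ?.
    by apply: is_derive_eq; rewrite /GRing.scale /= ; ring.
  by rewrite /f amplitude0 cos0 sin0 mulr1 mulr0 addr0 (cn_series0 p CS).
have C2 := circular_cn2 x; have cs := cos2Dsin2 (amplitude x).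
(* Equality case of Cauchy-Schwarz: both vectors have length C0. *)
have H : (C x - C0 * cos (amplitude x)) ^+ 2 + (S x - C0 * sin (amplitude x)) ^+ 2 = 0.
  transitivity ((C x ^+ 2 + S x ^+ 2) + C0 ^+ 2 * (cos (amplitude x) ^+ 2 + sin (amplitude x) ^+ 2)
     - 2 * C0 * f x); first by rewrite /f; ring.
  by rewrite fE cs C2; ring.
move/eqP: H; rewrite paddr_eq0 ?sqr_ge0// !sqrf_eq0 !subr_eq0.
by move=> /andP[/eqP ? /eqP ?].
Qed.

Lemma dn_amplitude x : D x = D0 * Num.sqrt (1 - series_modulus ^+ 2 * sin (amplitude x) ^+ 2).
Proof.
have D0p := dn_sum_gt0 p0.
have [_ Sx] := cn_sn_amplitude x.
have := circular_dn2 x; rewrite Sx => H.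
have -> : 1 - series_modulus ^+ 2 * sin (amplitude x) ^+ 2 = (D x / D0) ^+ 2.
  by rewrite [RHS]expr_div_n H /series_modulus; field; rewrite gt_eqF.
by rewrite sqrtr_sqr gtr0_norm ?divr_gt0 ?dn_series_gt0// mulrC divfK ?gt_eqF.
Qed.

Lemma ellipticF_amplitude x : ellipticF series_modulus (amplitude x) = 2 * D0 * x.
Proof.
apply: ellipticF_flow => [||y _]; [exact: series_modulus2_lt1|exact: amplitude0|].
by rewrite -mulrA -dn_amplitude; exact: is_derive_amplitude.
Qed.

(** The sines of the amplitude series vanish at pi/2, which is therefore fixed. *)
Lemma ellipticK_series_modulus : ellipticK series_modulus = pi * D0.
Proof. by rewrite /ellipticK -amplitude_pihalf ellipticF_amplitude; field. Qed.

Lemma jacobi_am_series x : jacobi_am series_modulus (2 * D0 * x) = amplitude x.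
Proof. by apply: jacobi_amE; [exact: series_modulus2_lt1|exact: ellipticF_amplitude]. Qed.

Lemma jacobi_cn_series x : jacobi_cn series_modulus (2 * D0 * x) = C x / C0.
Proof.
have [-> _] := cn_sn_amplitude x.
by rewrite /jacobi_cn jacobi_am_series mulrC mulKf// gt_eqF ?(cn_sum_gt0 p0).
Qed.

Lemma jacobi_sn_series x : jacobi_sn series_modulus (2 * D0 * x) = S x / C0.
Proof.
have [_ ->] := cn_sn_amplitude x.
by rewrite /jacobi_sn jacobi_am_series mulrC mulKf// gt_eqF ?(cn_sum_gt0 p0).
Qed.

Lemma jacobi_dn_series x : jacobi_dn series_modulus (2 * D0 * x) = D x / D0.
Proof.
by rewrite dn_amplitude /jacobi_dn /jacobi_sn jacobi_am_series [RHS]mulrC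
  mulKf// gt_eqF ?(dn_sum_gt0 p0).
Qed.

End Circular.

(** * The hyperbolic series and the complementary modulus *)

Section Hyperbolic.
Variable R : realType.
Implicit Types (x y : R).
Variable p : R.
Hypothesis p0 : 0 < p.

Let E x : R := cosh2 x / 2.
Let O x : R := sinh2 x / 2.
Notation C := (cn_series p E).
Notation S := (sn_series p O).
Notation D := (dn_series p E).
Notation C0 := (cn_sum p).
Notation D0 := (dn_sum p).
Let EO : cosine_pair E O 1 1 := @cosh_sinh_pair R.

Lemma hyperbolic_series_gt0 (a f : int -> R) x : (forall i, 0 < a i) ->
  decays p a f -> `|x| < p -> 0 < mode_sum a f E x.
Proof.
move=> a0 af xp.
have pos i : 0 < a i * E (f i * x) by rewrite mulr_gt0// divr_gt0// cosh2_gt0.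
apply: (@zsum_gt0 _ _ 0); [by move=> j; exact: ltW|exact: pos|].
by apply: (mode_sum_summable af (pairE_le EO)); rewrite mul1r.
Qed.

Lemma hyperbolic_cn_gt0 x : `|x| < p -> 0 < C x.
Proof.
apply: hyperbolic_series_gt0; last exact: decays_cn_coef.
by move=> i; rewrite invr_gt0 cosh2_gt0.
Qed.

Lemma hyperbolic_dn_gt0 x : `|x| < p -> 0 < D x.
Proof.
apply: hyperbolic_series_gt0; last exact: decays_dn_coef.
by move=> i; rewrite invr_gt0 cosh2_gt0.
Qed.

(** Jacobi's imaginary transformation sn (i y, k) = i tan (am (y, k')), solved for
    the amplitude of modulus k'. *)
Definition imag_amplitude x : R := atan (S x / C0).

Lemma imag_amplitude0 : imag_amplitude 0 = 0.
Proof. by rewrite /imag_amplitude (sn_series0 p EO) mul0r atan0. Qed.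

Lemma sin_atan2 (t : R) : sin (atan t) ^+ 2 = t ^+ 2 / (1 + t ^+ 2).
Proof.
have t1 : 0 < 1 + t ^+ 2 by rewrite ltr_pwDl ?sqr_ge0.
rewrite sin2cos2 cos_atan exprVn sqr_sqrtr; last exact: ltW.
by field; rewrite gt_eqF.
Qed.

Definition series_comodulus : R := Num.sqrt (1 - (series_modulus p) ^+ 2).

Lemma series_comodulus2 : series_comodulus ^+ 2 = 1 - series_modulus p ^+ 2.
Proof. by rewrite sqr_sqrtr// subr_ge0 ltW// series_modulus2_lt1. Qed.

Lemma series_comodulus2_lt1 : series_comodulus ^+ 2 < 1.
Proof. by rewrite series_comodulus2 ltrBlDr ltrDl exprn_gt0// series_modulus_gt0. Qed.

Lemma is_derive_imag_amplitude x : `|x| < p ->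
  is_derive x 1 imag_amplitude
    (2 * D0 * Num.sqrt (1 - series_comodulus ^+ 2 * sin (imag_amplitude x) ^+ 2)).
Proof.
move=> xp; have xp1 : 1 * `|x| < p by rewrite mul1r.
have C2 := cn_series2 p0 EO xp1; have D2 := dn_series2 p0 EO xp1.
rewrite mul1r in C2; rewrite mul1r in D2.
have Cp := hyperbolic_cn_gt0 xp; have Dp := hyperbolic_dn_gt0 xp.
have C0p := cn_sum_gt0 p0; have D0p := dn_sum_gt0 p0.
have n1 : C x != 0 by rewrite gt_eqF.
have n2 : C0 != 0 by rewrite gt_eqF.
have n3 : D0 != 0 by rewrite gt_eqF.
have S2 : S x ^+ 2 = C x ^+ 2 - C0 ^+ 2 by rewrite C2; ring.
have T2 : 1 + (S x / C0) ^+ 2 = C x ^+ 2 / C0 ^+ 2.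
  by rewrite expr_div_n S2; field.
have dS := is_derive_sn_series p0 EO xp1.
have -> : 1 - series_comodulus ^+ 2 * sin (imag_amplitude x) ^+ 2 = (C0 * D x / (D0 * C x)) ^+ 2.
  rewrite sin_atan2 T2 series_comodulus2 /series_modulus !expr_div_n !exprMn D2 S2.
  by field; rewrite n1 n2 n3.
rewrite sqrtr_sqr gtr0_norm ?divr_gt0 ?mulr_gt0//.
rewrite (_ : imag_amplitude = atan \o (C0^-1 \*: S)); last first.
  by apply/funext => y; rewrite /imag_amplitude mulrC.
apply: is_derive_eq; rewrite /GRing.scale /=.
rewrite -[C0^-1 *: S x]/(C0^-1 * S x) (mulrC C0^-1 (S x)) T2.
by field; rewrite n1 n2 n3.
Qed.

Lemma ellipticF_imag_amplitude x : `|x| < p ->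
  ellipticF series_comodulus (imag_amplitude x) = 2 * D0 * x.
Proof.
move=> xp; apply: ellipticF_flow => [||y yx];
  [exact: series_comodulus2_lt1|exact: imag_amplitude0|].
by apply: is_derive_imag_amplitude; exact: le_lt_trans yx xp.
Qed.

Lemma sn_term_ge0 i x : 0 <= x -> 0 <= sn_coef p i * O (odd_freq R i * x).
Proof.
move=> x0.
have H (j : int) : 0 < j -> 0 <= sn_coef p j * O (odd_freq R j * x).
  move=> j0; have f0 := odd_freq_gt0 R j0.
  rewrite mulr_ge0 ?invr_ge0 ?divr_ge0//.
    by rewrite ltW// sinh2_gt0// mulr_gt0.
  move: x0; rewrite le_eqVlt => /predU1P[<-|x0].
    by rewrite mulr0 /sinh2 oppr0 subrr.
  by rewrite ltW// sinh2_gt0// mulr_gt0.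
have [/H//|i0] := ltP 0 i.
have : 0 < 1 - i by lia.
by move/H; rewrite sn_coef_refl odd_freq_refl mulNr (mulNr (odd_freq R i)) (pairON EO) mulrN opprK.
Qed.

(** As x tends to p each term tends to 1/2, and all terms are nonnegative. *)
Lemma sn_series_cvgy : S x @[x --> p^'-] --> +oo.
Proof.
apply/cvgryPge => A.
(* The first N pairs of terms contribute N at the edge, hence at least A near it. *)
have [N AN] : exists N : nat, A + 1 <= N%:R.
  by exists (Num.truncn (A + 1)).+1; exact/ltW/truncnS_gt.
have part_p : series (zpair (fun i => sn_coef p i * O (odd_freq R i * p))) N = N%:R.
  have t i : sn_coef p i * O (odd_freq R i * p) = 2^-1.
    rewrite /sn_coef /O mulrA mulVf ?mul1r// sinh2_eq0 mulf_neq0 ?odd_freq_neq0 ?gt_eqF//.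
  rewrite /series /= (eq_bigr (fun=> 1)); last by move=> i _; rewrite /zpair !t; lra.
  by rewrite big_const_nat subn0 iter_addr_0.
have Oc : continuous O.
  move=> y; apply: differentiable_continuous; apply/derivable1_diffP.
  by have [] := pairdO EO y.
have : series (zpair (fun i => sn_coef p i * O (odd_freq R i * x))) N @[x --> p^'-] -->
    (N%:R : R).
  rewrite -part_p; apply: cvg_big => [|i _]; first exact: add_continuous.
  have H j : sn_coef p j * O (odd_freq R j * x) @[x --> p^'-] -->
      sn_coef p j * O (odd_freq R j * p).
    apply: cvgM; first exact: cvg_cst.
    apply: cvg_at_left_filter; apply: continuous_comp; last exact: Oc.
    by apply: cvgM; [exact: cvg_cst|exact: cvg_id].
  by apply: cvgD; exact: H.
move/cvgrPdist_lt => /(_ 1 ltr01) Hnear.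
near=> x.
have xp : x < p by near: x; exact: nbhs_left_lt.
have x0 : 0 < x by near: x; exact: nbhs_left_gt.
have : `|N%:R - series (zpair (fun i => sn_coef p i * O (odd_freq R i * x))) N| < 1 by near: x.
rewrite ltr_norml => /andP[_ H1].
have := @series_le_zsum _ (fun i => sn_coef p i * O (odd_freq R i * x)) N.
have Ss : zsummable (fun i => sn_coef p i * O (odd_freq R i * x)).
  by apply: (mode_sum_summable (decays_sn_coef p0) (pairO_le EO)); rewrite mul1r gtr0_norm.
move=> /(_ (fun i => sn_term_ge0 i (ltW x0)) Ss) H2.
by rewrite /sn_series /mode_sum; lra.
Unshelve. all: by end_near. Qed.

(** The imaginary amplitude reaches pi/2 at the edge p of the strip. *)
Lemma ellipticK_series_comodulus : ellipticK series_comodulus = 2 * D0 * p.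
Proof.
have C0p := cn_sum_gt0 p0.
have ampl : imag_amplitude x @[x --> p^'-] --> pi / 2.
  have H : S x / C0 @[x --> p^'-] --> +oo.
    apply/cvgryPge => A; have := sn_series_cvgy => /cvgryPge/(_ (A * C0)).
    by apply: filterS => x; rewrite ler_pdivlMr.
  exact: (@cvg_comp _ _ _ (fun x => S x / C0) (@atan R) _ _ _ H (@cvgy_atan R)).
have L1 : ellipticF series_comodulus (imag_amplitude x) @[x --> p^'-] -->
    ellipticK series_comodulus.
  have Fc := @continuous_ellipticF _ _ series_comodulus2_lt1 (pi / 2).
  exact: (@cvg_comp _ _ _ imag_amplitude (ellipticF series_comodulus) _ _ _ ampl Fc).
have L2 : ellipticF series_comodulus (imag_amplitude x) @[x --> p^'-] --> 2 * D0 * p.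
  have : 2 * D0 * x @[x --> p^'-] --> 2 * D0 * p.
    apply: cvg_at_left_filter; apply: cvgM; [exact: cvg_cst|exact: cvg_id].
  apply: cvg_trans; apply: near_eq_cvg; near=> x.
  have xp : x < p by near: x; exact: nbhs_left_lt.
  have x0 : 0 < x by near: x; exact: nbhs_left_gt.
  by rewrite ellipticF_imag_amplitude// gtr0_norm.
exact: (cvg_unique _ L1 L2).
Unshelve. all: by end_near. Qed.

End Hyperbolic.

Section Modulus.
Variable R : realType.
Implicit Types (k : R).

(** The p for which nome k = exp (- 2 p). *)
Definition nome_exponent k : R := pi * ellipticK' k / (2 * ellipticK k).

Lemma compl_modulus k : 0 < k -> k < 1 ->
  0 <= Num.sqrt (1 - k ^+ 2) < 1 /\ Num.sqrt (1 - k ^+ 2) ^+ 2 < 1 /\ k ^+ 2 < 1.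
Proof.
move=> k0 k1.
have k2 : k ^+ 2 < 1 by rewrite expr_lt1// ltW.
have k2' : Num.sqrt (1 - k ^+ 2) ^+ 2 < 1.
  by rewrite sqr_sqrtr ?subr_ge0 1?ltW// ltrBlDr ltrDl exprn_gt0.
have k'1 : Num.sqrt (1 - k ^+ 2) < 1.
  by move: k2'; rewrite expr_lt1// sqrtr_ge0.
by rewrite sqrtr_ge0 k'1.
Qed.

Lemma nome_exponent_gt0 k : 0 < k -> k < 1 -> 0 < nome_exponent k.
Proof.
move=> k0 k1; have [_ [k2' k2]] := compl_modulus k0 k1.
by rewrite divr_gt0 ?mulr_gt0 ?pi_gt0 ?ellipticK_gt0.
Qed.

Lemma lt_nome_exponent k m : 0 < k -> k < m -> m < 1 ->
  nome_exponent m < nome_exponent k.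
Proof.
move=> k0 km m1; have k1 := lt_trans km m1; have m0 := lt_trans k0 km.
have [k'01 [k2' k2]] := compl_modulus k0 k1.
have [m'01 [m2' m2]] := compl_modulus m0 m1.
have HK : ellipticK k < ellipticK m by apply: lt_ellipticK => //; exact: ltW.
have HK' : ellipticK' m < ellipticK' k.
  apply: lt_ellipticK; [by case/andP: m'01| |by case/andP: k'01].
  by rewrite ltr_sqrt ?subr_gt0// ltrD2l ltrN2 ltr_pXn2r ?nnegrE ?ltW.
have ? := ellipticK_gt0 k2; have ? := ellipticK_gt0 m2.
have ? := ellipticK_gt0 k2'; have ? := ellipticK_gt0 m2'.
rewrite /nome_exponent ltr_pdivrMr ?mulr_gt0// mulrAC ltr_pdivlMr ?mulr_gt0//.
rewrite -!mulrA ltr_pM2l ?pi_gt0//; apply: ltr_pM => //; rewrite ?ltW//.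
  by rewrite mulr_gt0.
by rewrite ltr_pM2l.
Qed.

Lemma series_modulusK (p : R) : 0 < p -> nome_exponent (series_modulus p) = p.
Proof.
move=> p0; rewrite /nome_exponent ellipticK_series_modulus// /ellipticK'
  ellipticK_series_comodulus//.
have n1 : dn_sum p != 0 by rewrite gt_eqF ?(dn_sum_gt0 p0).
have n2 : pi != 0 :> R by rewrite gt_eqF ?pi_gt0.
by move: n2; move: (@pi R) => P n2; field; rewrite n1 n2.
Qed.

(** The nome determines the modulus, K'/K being strictly monotone; thus k is the
    modulus of the series built on its own nome. *)
Lemma nome_exponentK k : 0 < k -> k < 1 -> series_modulus (nome_exponent k) = k.
Proof.
move=> k0 k1; set p := nome_exponent k.
have p0 : 0 < p := nome_exponent_gt0 k0 k1.
have := series_modulus_gt0 p0; have := series_modulus_lt1 p0.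
have := series_modulusK p0.
move=> E kp1 kp0.
have [H|H|//] := ltgtP (series_modulus p) k.
  by have := lt_nome_exponent kp0 H k1; rewrite E ltxx.
by have := lt_nome_exponent k0 H kp1; rewrite E ltxx.
Qed.

End Modulus.

(** * The Jacobi functions on the real line *)

Section JacobiFunctions.
Variable R : realType.
Variable k : R.
Hypotheses (k0 : 0 < k) (k1 : k < 1).
Implicit Types (u v x : R).

Let p := nome_exponent k.
Let p0 : 0 < p := nome_exponent_gt0 k0 k1.
Let kE : series_modulus p = k := nome_exponentK k0 k1.
Let L : R := (2 * dn_sum p)^-1.

Let D0n : dn_sum p != 0. Proof. by rewrite gt_eqF ?(dn_sum_gt0 p0). Qed.
Let C0n : cn_sum p != 0. Proof. by rewrite gt_eqF ?(cn_sum_gt0 p0). Qed.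

Let LE u : 2 * dn_sum p * (L * u) = u.
Proof. by rewrite /L mulrA mulfV ?mul1r// mulf_neq0 ?pnatr_eq0. Qed.

Let C0E : k * dn_sum p = cn_sum p. Proof. by rewrite -kE /series_modulus divfK. Qed.

(** The real variable is rescaled so that the quarter period K becomes pi/2. *)
Lemma jacobi_cnE u : jacobi_cn k u = cn_series p cos (L * u) / cn_sum p.
Proof. by rewrite -{1}(LE u) -kE jacobi_cn_series. Qed.

Lemma jacobi_snE u : jacobi_sn k u = sn_series p sin (L * u) / cn_sum p.
Proof. by rewrite -{1}(LE u) -kE jacobi_sn_series. Qed.

Lemma jacobi_dnE u : jacobi_dn k u = dn_series p cos (L * u) / dn_sum p.
Proof. by rewrite -{1}(LE u) -kE jacobi_dn_series. Qed.

Let dlin u : is_derive u 1 ( *%R L) L.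
Proof.
rewrite (_ : *%R _ = L \*: id); last by apply/funext.
by apply: is_derive_eq; rewrite [_ *: 1]mulr1.
Qed.

Lemma is_derive_jacobi_sn u :
  is_derive u 1 (jacobi_sn k) (jacobi_cn k u * jacobi_dn k u).
Proof.
rewrite (_ : jacobi_sn k = (cn_sum p)^-1 \*: (sn_series p sin \o ( *%R L))); last first.
  by apply/funext => v; rewrite jacobi_snE mulrC.
have := circular_dsn p0 (L * u) => ?.
apply: is_derive_eq; rewrite jacobi_cnE jacobi_dnE /GRing.scale /= /L.
by field; rewrite C0n D0n.
Qed.

Lemma is_derive_jacobi_cn u :
  is_derive u 1 (jacobi_cn k) (- (jacobi_sn k u * jacobi_dn k u)).
Proof.
rewrite (_ : jacobi_cn k = (cn_sum p)^-1 \*: (cn_series p cos \o ( *%R L))); last first.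
  by apply/funext => v; rewrite jacobi_cnE mulrC.
have := circular_dcn p0 (L * u) => ?.
apply: is_derive_eq; rewrite jacobi_snE jacobi_dnE /GRing.scale /= /L.
by field; rewrite C0n D0n.
Qed.

Lemma is_derive_jacobi_dn u :
  is_derive u 1 (jacobi_dn k) (- (k ^+ 2 * (jacobi_sn k u * jacobi_cn k u))).
Proof.
rewrite (_ : jacobi_dn k = (dn_sum p)^-1 \*: (dn_series p cos \o ( *%R L))); last first.
  by apply/funext => v; rewrite jacobi_dnE mulrC.
have := circular_ddn p0 (L * u) => ?.
have kD : k = cn_sum p / dn_sum p by rewrite -C0E mulfK.
apply: is_derive_eq; rewrite jacobi_snE jacobi_cnE kD /GRing.scale /= /L.
by field; rewrite C0n D0n.
Qed.

Let am0 : jacobi_am k 0 = 0.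
Proof. by have := jacobi_am_series p0 0; rewrite mulr0 amplitude0 kE. Qed.

Lemma jacobi_sn0 : jacobi_sn k 0 = 0.
Proof. by rewrite /jacobi_sn am0 sin0. Qed.

Lemma jacobi_cn0 : jacobi_cn k 0 = 1.
Proof. by rewrite /jacobi_cn am0 cos0. Qed.

Lemma jacobi_dn0 : jacobi_dn k 0 = 1.
Proof. by rewrite /jacobi_dn jacobi_sn0 expr0n mulr0 subr0 sqrtr1. Qed.

Lemma jacobi_cnN u : jacobi_cn k (- u) = jacobi_cn k u.
Proof.
rewrite !jacobi_cnE; congr (_ / _); apply: eq_zsum => i.
by rewrite !mulrN cosN.
Qed.

Lemma jacobi_snN u : jacobi_sn k (- u) = - jacobi_sn k u.
Proof.
rewrite !jacobi_snE -mulNr; congr (_ / _); rewrite /sn_series /mode_sum -zsumN.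
  by apply: eq_zsum => i; rewrite !mulrN sinN mulrN.
apply: (mode_sum_summable (decays_sn_coef p0) (pairO_le (@cos_sin_pair R))).
by rewrite mul0r.
Qed.

Lemma jacobi_dnN u : jacobi_dn k (- u) = jacobi_dn k u.
Proof. by rewrite /jacobi_dn jacobi_snN sqrrN. Qed.

Lemma jacobi_cn2 u : jacobi_cn k u ^+ 2 = 1 - jacobi_sn k u ^+ 2.
Proof. exact: cos2sin2. Qed.

Let k2 : k ^+ 2 < 1. Proof. by rewrite expr_lt1// ltW. Qed.

Lemma jacobi_dn2 u : jacobi_dn k u ^+ 2 = 1 - k ^+ 2 * jacobi_sn k u ^+ 2.
Proof. by rewrite sqr_sqrtr// ltW// modulus_gt0. Qed.

Let Delta u v : R := 1 - k ^+ 2 * jacobi_sn k u ^+ 2 * jacobi_sn k v ^+ 2.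

Let Delta_gt0 u v : 0 < Delta u v.
Proof.
rewrite subr_gt0; apply: le_lt_trans k2.
have s1 x : jacobi_sn k x ^+ 2 <= 1.
  by rewrite -subr_ge0 -jacobi_cn2 sqr_ge0.
by rewrite -mulrA ler_piMr ?sqr_ge0// mulr_ile1 ?sqr_ge0.
Qed.

Let const_quotient (N D dN dD : R -> R) : (forall v, 0 < D v) ->
  (forall v, is_derive v 1 N (dN v)) -> (forall v, is_derive v 1 D (dD v)) ->
  (forall v, dN v * D v = N v * dD v) -> forall v, N v / D v = N 0 / D 0.
Proof.
move=> D0 dNE dDE E v.
apply: (@is_derive_0_is_cst _ (fun v => N v / D v)) => {}v.
have Dn : D v != 0 by rewrite gt_eqF.
rewrite (_ : (fun _ => _) = N * (fun v => (D v)^-1)); last by apply/funext.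
have := dNE v; have := is_deriveV Dn (dDE v) => ? ?.
apply: is_derive_eq; rewrite /GRing.scale /=.
transitivity ((dN v * D v - N v * dD v) / D v ^+ 2); first by field.
by rewrite E subrr mul0r.
Qed.

Let d_shift (f : R -> R) e v df : is_derive (v + e) 1 f df ->
  is_derive v 1 (fun v => f (v + e)) df.
Proof.
move=> fdf; rewrite (_ : (fun _ => _) = f \o (+%R^~ e))//.
have H : is_derive v 1 (+%R^~ e) (1 : R).
  rewrite (_ : +%R^~ e = id + cst e); last by apply/funext.
  by apply: is_derive_eq; rewrite addr0.
by apply: is_derive_eq; rewrite mulr1.
Qed.

(** When u - v is fixed the classical quotients do not depend on v: their
    derivatives vanish. At v = 0 they reduce to cn and dn of u - v. *)
Lemma jacobi_quotients u v :
  jacobi_cn k (u - v) = (jacobi_cn k u * jacobi_cn k v +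
    jacobi_sn k u * jacobi_sn k v * (jacobi_dn k u * jacobi_dn k v)) / Delta u v /\
  jacobi_dn k (u - v) = (jacobi_dn k u * jacobi_dn k v +
    k ^+ 2 * (jacobi_sn k u * jacobi_sn k v) * (jacobi_cn k u * jacobi_cn k v)) / Delta u v.
Proof.
pose e := u - v.
have -> : u = v + e by rewrite /e addrC subrK.
rewrite [v + e - v]addrC addKr; move: e => e.
pose s := jacobi_sn k; pose c := jacobi_cn k; pose d := jacobi_dn k.
pose s1 x := s (x + e); pose c1 x := c (x + e); pose d1 x := d (x + e).
have ds x : is_derive x 1 s (c x * d x) by exact: is_derive_jacobi_sn.
have dc x : is_derive x 1 c (- (s x * d x)) by exact: is_derive_jacobi_cn.
have dd x : is_derive x 1 d (- (k ^+ 2 * (s x * c x))) by exact: is_derive_jacobi_dn.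
have ds1 x : is_derive x 1 s1 (c1 x * d1 x) by exact: d_shift.
have dc1 x : is_derive x 1 c1 (- (s1 x * d1 x)) by exact: d_shift.
have dd1 x : is_derive x 1 d1 (- (k ^+ 2 * (s1 x * c1 x))) by exact: d_shift.
have c2 x : c x ^+ 2 = 1 - s x ^+ 2 by exact: jacobi_cn2.
have d2 x : d x ^+ 2 = 1 - k ^+ 2 * s x ^+ 2 by exact: jacobi_dn2.
have c12 x : c1 x ^+ 2 = 1 - s1 x ^+ 2 by exact: jacobi_cn2.
have d12 x : d1 x ^+ 2 = 1 - k ^+ 2 * s1 x ^+ 2 by exact: jacobi_dn2.
pose Q x : R := 1 - k ^+ 2 * s1 x ^+ 2 * s x ^+ 2.
pose dQ x : R := - 2 * k ^+ 2 * (s1 x * s x) * (s x * c1 x * d1 x + s1 x * c x * d x).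
have Q0 x : 0 < Q x by exact: Delta_gt0.
have dQE x : is_derive x 1 Q (dQ x).
  rewrite (_ : Q = cst 1 - k ^+ 2 \*: (s1 ^+ 2 * s ^+ 2)); last first.
    by apply/funext => y; rewrite /Q -mulrA.
  have := ds x; have := ds1 x => ? ?.
  by apply: is_derive_eq; rewrite /dQ /GRing.scale /= !fctE; ring.
pose M x : R := c1 x * c x + s1 x * s x * (d1 x * d x).
pose dM x : R := - 2 * k ^+ 2 * (s1 x * s x) * (c1 x * d x * s1 x + d1 x * c x * s x).
have dME x : is_derive x 1 M (dM x).
  rewrite (_ : M = c1 * c + (s1 * s) * (d1 * d)); last by apply/funext.
  have := ds x; have := ds1 x; have := dc x => ? ? ?.
  have := dc1 x; have := dd x; have := dd1 x => ? ? ?.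
  apply: is_derive_eq; rewrite /GRing.scale /= !fctE.
  (* Grouped so that each bracket reduces by dn^2 = 1 - k^2 sn^2. *)
  transitivity (c1 x * s x * d x * (d1 x ^+ 2 - 1 - k ^+ 2 * s1 x ^+ 2)
     + s1 x * d1 x * c x * (d x ^+ 2 - 1 - k ^+ 2 * s x ^+ 2)); first by ring.
  by rewrite d2 d12 /dM; ring.
pose N x : R := d1 x * d x + k ^+ 2 * (s1 x * s x) * (c1 x * c x).
pose dN x : R := - 2 * k ^+ 2 * (s1 x * s x) * (s1 x * d1 x * c x + s x * c1 x * d x).
have dNE x : is_derive x 1 N (dN x).
  rewrite (_ : N = d1 * d + k ^+ 2 \*: ((s1 * s) * (c1 * c))); last first.
    by apply/funext => y; rewrite /N -mulrA.
  have := ds x; have := ds1 x; have := dc x => ? ? ?.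
  have := dc1 x; have := dd x; have := dd1 x => ? ? ?.
  apply: is_derive_eq; rewrite /GRing.scale /= !fctE.
  transitivity (k ^+ 2 * (d1 x * s x * c x * (c1 x ^+ 2 - s1 x ^+ 2 - 1)
     + s1 x * c1 x * d x * (c x ^+ 2 - s x ^+ 2 - 1))); first by ring.
  by rewrite c2 c12 /dN; ring.
have s0 : s 0 = 0 := jacobi_sn0; have c0 : c 0 = 1 := jacobi_cn0.
have d0 : d 0 = 1 := jacobi_dn0.
have EM x : dM x * Q x = M x * dQ x.
  rewrite /dM /dQ /M /Q.
  transitivity (- 2 * k ^+ 2 * (s1 x * s x) * ((c1 x * c x + s1 x * s x * (d1 x * d x)) *
    (s x * c1 x * d1 x + s1 x * c x * d x)
   + c1 x * d x * s1 x * (1 - k ^+ 2 * s1 x ^+ 2 * s x ^+ 2 - c x ^+ 2 - s x ^+ 2 * d1 x ^+ 2)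
   + d1 x * c x * s x * (1 - k ^+ 2 * s1 x ^+ 2 * s x ^+ 2 - c1 x ^+ 2 - s1 x ^+ 2 * d x ^+ 2)));
   first by ring.
  by rewrite c2 d2 c12 d12; ring.
have EN x : dN x * Q x = N x * dQ x.
  rewrite /dN /dQ /N /Q.
  transitivity (- 2 * k ^+ 2 * (s1 x * s x) * ((d1 x * d x + k ^+ 2 * (s1 x * s x) * (c1 x * c x)) *
    (s x * c1 x * d1 x + s1 x * c x * d x)
   + s1 x * d1 x * c x * (1 - k ^+ 2 * s1 x ^+ 2 * s x ^+ 2 - d x ^+ 2
       - k ^+ 2 * s x ^+ 2 * c1 x ^+ 2)
   + s x * c1 x * d x * (1 - k ^+ 2 * s1 x ^+ 2 * s x ^+ 2 - d1 x ^+ 2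
       - k ^+ 2 * s1 x ^+ 2 * c x ^+ 2)));
   first by ring.
  by rewrite c2 d2 c12 d12; ring.
have Q00 : Q 0 = 1 by rewrite /Q s0 expr0n mulr0 subr0.
have M0 : M 0 = c e by rewrite /M s0 c0 d0 mulr0 mul0r addr0 mulr1 /c1 add0r.
have N0 : N 0 = d e by rewrite /N s0 c0 d0 !mulr0 mul0r addr0 mulr1 /d1 add0r.
split; first by have := const_quotient Q0 dME dQE EM v; rewrite Q00 M0 divr1.
by have := const_quotient Q0 dNE dQE EN v; rewrite Q00 N0 divr1.
Qed.

(** A form of the addition theorem which has a value at u - v on both sides: read
    as a recurrence, it has the shape of the recurrence of the polynomials. *)
Lemma jacobi_cnB u v : jacobi_cn k (u - v) =
  jacobi_cn k u * jacobi_cn k v + jacobi_sn k u * jacobi_sn k v * jacobi_dn k (u - v).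
Proof.
have Dn : Delta u v != 0 by rewrite gt_eqF.
have [-> ->] := jacobi_quotients u v.
by move: Dn; rewrite /Delta -!exprMn => Dn; field.
Qed.

Lemma jacobi_dnB u v : jacobi_dn k (u - v) =
  jacobi_dn k u * jacobi_dn k v + k ^+ 2 * (jacobi_sn k u * jacobi_sn k v * jacobi_cn k (u - v)).
Proof.
have Dn : Delta u v != 0 by rewrite gt_eqF.
have [-> ->] := jacobi_quotients u v.
by move: Dn; rewrite /Delta -!exprMn => Dn; field.
Qed.

Lemma weightE s : weight k s = (cn_sum p)^-1 * cn_coef p s.
Proof.
have Kp : ellipticK k = pi * dn_sum p by rewrite -kE ellipticK_series_modulus.
have pn : pi != 0 :> R by rewrite gt_eqF ?pi_gt0.
have nomeE : nome k = expR (- (2 * p)).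
  rewrite /nome /p /nome_exponent; congr expR.
  have K0 : ellipticK k != 0 by rewrite gt_eqF// ellipticK_gt0.
  by field.
rewrite /weight Kp nomeE -!expRM /cn_coef /cosh2; congr (_ * _).
  by rewrite -C0E; move: pn; move: (@pi R) => P Pn; field; rewrite Pn D0n gt_eqF.
have -> : - (2 * p) * (s%:~R - 2^-1) = - (odd_freq R s * p).
  by rewrite /odd_freq intrB intrM; field.
have -> : - (2 * p) * (- s%:~R + 2^-1) = odd_freq R s * p.
  by rewrite /odd_freq intrB intrM; field.
by rewrite addrC.
Qed.

Lemma weight_summable (X : R -> R) x : (forall y, `|X y| <= 1) ->
  zsummable (fun s => weight k s * X (odd_freq R s * x)).
Proof.
move=> X1; apply: (@zsummable_le _ _ (fun s => `|weight k s|)).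
  by move=> s; rewrite normrM ler_piMr.
apply: zsummable_norm; apply: eq_zsummable (zsummableZ _) (fun s => esym (weightE s)).
exact: cn_coef_summable.
Qed.

(** The Fourier series of cn: the moments of the weights are values of cn. *)
Lemma weight_cos u :
  zsum (fun s => weight k s * cos (odd_freq R s * (pi * u / (2 * ellipticK k)))) = jacobi_cn k u.
Proof.
have Kp : ellipticK k = pi * dn_sum p by rewrite -kE ellipticK_series_modulus.
have pn : pi != 0 :> R by rewrite gt_eqF ?pi_gt0.
have -> : pi * u / (2 * ellipticK k) = L * u.
  by rewrite Kp /L; move: pn; move: (@pi R) => P Pn; field; rewrite Pn D0n.
rewrite jacobi_cnE [RHS]mulrC /cn_series /mode_sum -zsumZ.
  by apply: eq_zsum => s; rewrite weightE -mulrA.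
apply: (mode_sum_summable (decays_cn_coef p0) (pairE_le (@cos_sin_pair R))).
by rewrite mul0r.
Qed.

(** The reflection s -> 1 - s conjugates the nodes and keeps the weights. *)
Lemma weight_sin x : zsum (fun s => weight k s * sin (odd_freq R s * x)) = 0.
Proof.
have Ss := @weight_summable sin x (@sin_max R).
have E : zsum (fun s => weight k s * sin (odd_freq R s * x)) =
       - zsum (fun s => weight k s * sin (odd_freq R s * x)).
  rewrite -zsumN// -{1}(zsum_reflect 1 Ss).2; apply: eq_zsum => s.
  by rewrite !weightE cn_coef_refl odd_freq_refl mulNr sinN mulrN.
by lra.
Qed.

End JacobiFunctions.

(** * Functions of the second kind *)

(** What the orthogonality takes from the Jacobi functions, m being the square of
    the modulus; the rest of the argument is algebra in a commutative ring. *)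
Record elliptic_triple (R : comNzRingType) (m : R) (sn cn dn : R -> R) : Prop :=
  EllipticTriple {
  etrip_sn0 : sn 0 = 0;
  etrip_cn0 : cn 0 = 1;
  etrip_dn0 : dn 0 = 1;
  etrip_snN : forall u, sn (- u) = - sn u;
  etrip_cnN : forall u, cn (- u) = cn u;
  etrip_dnN : forall u, dn (- u) = dn u;
  etrip_cn2 : forall u, cn u ^+ 2 = 1 - sn u ^+ 2;
  etrip_dn2 : forall u, dn u ^+ 2 = 1 - m * sn u ^+ 2;
  etrip_cnB : forall u v, cn (u - v) = cn u * cn v + sn u * sn v * dn (u - v);
  etrip_dnB : forall u v, dn (u - v) = dn u * dn v + m * (sn u * sn v * cn (u - v)) }.

Section SzegoFunctions.
Variables (R : comNzRingType) (m : R) (sn cn dn : R -> R).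
Hypothesis T : elliptic_triple m sn cn dn.
Variables (w : R) (a : nat -> R).
Hypothesis aE : forall n, a n = if odd n then - dn (w * n.+1%:R) else cn (w * n.+1%:R).
Implicit Types (u v : R) (n l : nat).

(** The function of the second kind: with cn (w j) as j-th moment, its value at w j
    is the inner product of Phi_n with z^j. Letting u vary
    over the whole ring exposes the zeros of the function. *)
Definition second_kind n u : R := \sum_(l < n.+1) (Phi a n)`_l * cn (w * l%:R - u).

(** The recurrence of the polynomials. The reversal becomes the reflection
    u -> w n - u because cn is even. *)
Lemma second_kindS n u :
  second_kind n.+1 u = second_kind n (u - w) - a n * second_kind n (w * n%:R - u).
Proof.
rewrite /second_kind /=.
under eq_bigr => l _ do rewrite coefB coefZ mulrBl -mulrA.
rewrite sumrB -mulr_sumr; congr (_ - _ * _).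
  rewrite big_ord_recl coefXM /= mul0r add0r; apply: eq_bigr => l _.
  by rewrite coefXM /= /bump /= add1n -natr1; congr (_ * cn _); ring.
rewrite big_ord_recr /= coef_poly ltnn mul0r addr0.
rewrite (reindex_inj rev_ord_inj) /=; apply: eq_bigr => l _.
have ln : (l <= n)%N by rewrite -ltnS.
rewrite coef_poly subSS ltnS leq_subr subKn//; congr (_ * _).
by rewrite -(etrip_cnN T) natrB//; congr cn; ring.
Qed.

(** The factor of the n-th function which is not a value of sn alternates between
    cn and dn; their two addition theorems then merge into tail_funB. *)
Definition tail_fun n : R -> R := if odd n then dn else cn.

Definition sn_prod n u : R := \prod_(j < n) sn (u - w * j%:R).

Definition lead_factor n : R :=
  \prod_(j < n) ((if odd j then m else 1) * sn (w * j.+1%:R)).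

Lemma sn_prod_shift n u : sn_prod n.+1 u = sn u * sn_prod n (u - w).
Proof.
rewrite /sn_prod big_ord_recl mulr0 subr0; congr (_ * _).
by apply: eq_bigr => j _; rewrite lift0 -natr1; congr sn; ring.
Qed.

Lemma sn_prod_reverse n u : sn_prod n (w * n%:R - u) = (-1) ^+ n * sn_prod n (u - w).
Proof.
rewrite /sn_prod (reindex_inj rev_ord_inj) /=.
transitivity (\prod_(j < n) (- 1 * sn (u - w - w * j%:R))).
  apply: eq_bigr => j _; rewrite mulN1r -(etrip_snN T) natrB//; congr sn.
  by rewrite -natr1; ring.
by rewrite big_split /= prodr_const card_ord.
Qed.

Lemma tail_funN n u : tail_fun n (- u) = tail_fun n u.
Proof. by rewrite /tail_fun; case: odd; [exact: etrip_dnN T _|exact: etrip_cnN T _]. Qed.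

Lemma tail_funB n u v : (if odd n then m else 1) * (sn u * sn v * tail_fun n.+1 (u - v)) =
  tail_fun n (u - v) - tail_fun n v * tail_fun n u.
Proof.
rewrite /tail_fun /=; case: odd => /=.
  by rewrite (etrip_dnB T); ring.
by rewrite (etrip_cnB T); ring.
Qed.

Lemma tail_fun_refl n : a n * (-1) ^+ n = tail_fun n (w * n.+1%:R).
Proof.
by rewrite aE /tail_fun -signr_odd; case: odd; rewrite /= ?expr1 ?expr0 ?mulrN1 ?opprK ?mulr1.
Qed.

(** The recurrence reproduces the product: after removal of the common factors, what
    remains at each step is one of the two addition theorems. *)
Lemma second_kindE n u :
  second_kind n u = lead_factor n * sn_prod n u * tail_fun n (u - w * n%:R).
Proof.
elim: n u => [|n IH] u.
  rewrite /second_kind /lead_factor /sn_prod big_ord1 !big_ord0 coef1 !mul1r /tail_fun /=.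
  by rewrite mulr0 sub0r subr0 (etrip_cnN T).
rewrite second_kindS !IH sn_prod_reverse sn_prod_shift.
rewrite (_ : w * n%:R - u - w * n%:R = - u); last by ring.
rewrite tail_funN.
rewrite (_ : u - w - w * n%:R = u - w * n.+1%:R); last by rewrite -natr1; ring.
rewrite /lead_factor big_ord_recr /= -/(lead_factor n).
have := tail_funB n u (w * n.+1%:R); rewrite -tail_fun_refl.
move: (if odd n then m else 1) => c E.
transitivity (lead_factor n * sn_prod n (u - w) *
  (c * (sn u * sn (w * n.+1%:R) * tail_fun n.+1 (u - w * n.+1%:R)))); last by ring.
by rewrite E; ring.
Qed.

Lemma second_kind_eq0 n j : (j < n)%N -> second_kind n (w * j%:R) = 0.
Proof.
move=> jn; rewrite second_kindE /sn_prod (bigD1 (Ordinal jn)) //= subrr.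
by rewrite (etrip_sn0 T) mul0r mulr0 mul0r.
Qed.

(** The factors of the product at u = w n are 1 - a_j^2, because 1 - cn^2 = sn^2 and
    1 - dn^2 = m sn^2. *)
Lemma second_kind_diag n : second_kind n (w * n%:R) = hnorm a n.
Proof.
rewrite second_kindE subrr.
have -> : tail_fun n 0 = 1.
  by rewrite /tail_fun; case: odd; [exact: etrip_dn0 T|exact: etrip_cn0 T].
rewrite mulr1 /sn_prod (reindex_inj rev_ord_inj) /= -big_split /=.
apply: eq_bigr => j _.
rewrite -mulrBr -natrB ?leq_subr// subnBA ?(ltn_ord j)// addKn aE.
case: odd; last by rewrite (etrip_cn2 T); ring.
by rewrite sqrrN (etrip_dn2 T); ring.
Qed.

(** Expanding the polynomial of lower degree leaves values of the function of the
    second kind at 0, w, ..., of which only the leading one can be nonzero. *)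
Lemma Phi_gram n n' : (n' <= n)%N ->
  \sum_(l < n.+1) \sum_(j < n'.+1)
    (Phi a n)`_l * (Phi a n')`_j * cn (w * l%:R - w * j%:R) = hnorm a n * (n == n')%:R.
Proof.
move=> n'n; rewrite exchange_big /=.
transitivity (\sum_(j < n'.+1) (Phi a n')`_j * second_kind n (w * j%:R)).
  apply: eq_bigr => j _; rewrite /second_kind mulr_sumr; apply: eq_bigr => l _.
  by ring.
rewrite big_ord_recr big1 /= => [|j _]; last first.
  by rewrite second_kind_eq0 ?mulr0// (leq_trans (ltn_ord j)).
rewrite add0r; have [<-|nn'] := eqVneq n n'.
  have [sz mon] := size_Phi a n; move: mon; rewrite monicE lead_coefE sz => /eqP ->.
  by rewrite mul1r mulr1 second_kind_diag.
by rewrite second_kind_eq0 ?mulr0// ltn_neqAle eq_sym nn'.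
Qed.

Lemma Phi_gram_sym n n' :
  \sum_(l < n.+1) \sum_(j < n'.+1)
    (Phi a n)`_l * (Phi a n')`_j * cn (w * l%:R - w * j%:R) = hnorm a n * (n == n')%:R.
Proof.
have [|nn'] := leqP n' n; first exact: Phi_gram.
rewrite (ltn_eqF nn') mulr0 exchange_big /=.
transitivity (hnorm a n' * (n' == n)%:R); last by rewrite (gtn_eqF nn') mulr0.
rewrite -(Phi_gram (ltnW nn')); apply: eq_bigr => j _; apply: eq_bigr => l _.
rewrite -(etrip_cnN T) opprB; ring.
Qed.

End SzegoFunctions.

(** * Complex sums and the orthogonality relation *)

Section ComplexSums.
Variable R : realType.
Implicit Types (f g : int -> R) (s : int) (t x : R).

Lemma cvg_complex (u v : nat -> R) (a b : R) :
  u @ \oo --> a -> v @ \oo --> b ->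
  (fun n => (u n +i* v n)%C : R[i]^o) @ \oo --> ((a +i* b)%C : R[i]^o).
Proof.
move=> ua vb; apply/cvgrPdist_lt => eps eps0.
have [e eE] : exists e : R, eps = (e%:C)%C by apply/complex_realP; exact: gtr0_real.
move: eps0; rewrite eE ltcR => e0.
have e2 : 0 < e / 2 by rewrite divr_gt0.
have /cvgrPdist_lt/(_ _ e2) Hu := ua.
have /cvgrPdist_lt/(_ _ e2) Hv := vb.
near=> n.
have un : `|a - u n| < e / 2 by near: n.
have vn : `|b - v n| < e / 2 by near: n.
rewrite normc_def ltcR /=.
rewrite -(ger0_norm (ltW e0)) -sqrtr_sqr ltr_sqrt ?exprn_gt0//.
rewrite -(real_normK (num_real (a - u n))) -(real_normK (num_real (b - v n))).
have := normr_ge0 (a - u n); have := normr_ge0 (b - v n).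
by nra.
Unshelve. all: by end_near. Qed.

Lemma series_complex (u v : nat -> R) :
  series (fun n => (u n +i* v n)%C : R[i]^o) =
  (fun n => (series u n +i* series v n)%C).
Proof.
apply/funext; elim=> [|n IH]; first by rewrite /series /= !big_geq.
by rewrite !seriesSr IH.
Qed.

Lemma zsummable_halves f : zsummable f ->
  cvgn (series (fun n : nat => f n%:Z)) /\ cvgn (series (fun n : nat => f (- n.+1%:Z))).
Proof.
move=> fs; split; apply: normed_cvg; apply: (series_le_cvg _ _ _ fs) => n //=;
  by rewrite /zpair ?addr_ge0 ?lerDl ?lerDr.
Qed.

Lemma zsum_halves f : zsummable f ->
  zsum f = limn (series (fun n : nat => f n%:Z)) + limn (series (fun n : nat => f (- n.+1%:Z))).
Proof.
move=> fs; have [c1 c2] := zsummable_halves fs; apply: zsum_unique.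
have -> : series (zpair f) = series (fun n : nat => f n%:Z) \+
    series (fun n : nat => f (- n.+1%:Z)).
  by apply/funext => n; rewrite /series /= -big_split.
exact: cvgD.
Qed.

Lemma zsum_to_complex f g : zsummable f -> zsummable g ->
  zsum_to (fun s => (f s +i* g s)%C) (zsum f +i* zsum g)%C.
Proof.
move=> fs gs; have [f1 f2] := zsummable_halves fs; have [g1 g2] := zsummable_halves gs.
exists (limn (series (fun n : nat => f n%:Z)) +i* limn (series (fun n : nat => g n%:Z)))%C.
exists (limn (series (fun n : nat => f (- n.+1%:Z))) +i*
        limn (series (fun n : nat => g (- n.+1%:Z))))%C.
rewrite !series_complex; split; [exact: cvg_complex|exact: cvg_complex|].
by rewrite !zsum_halves.
Qed.

Lemma expiD t x : expi (t + x) = expi t * expi x :> R[i].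
Proof.
rewrite /expi cosD sinD; apply/eqP; rewrite eq_complex /=.
by apply/andP; split; apply/eqP; ring.
Qed.

Lemma expi0 : expi 0 = 1 :> R[i].
Proof. by rewrite /expi cos0 sin0. Qed.

Lemma expi_natr t n : expi t ^+ n = expi (n%:R * t) :> R[i].
Proof.
elim: n => [|n IH]; first by rewrite mul0r expi0.
by rewrite exprS IH -expiD; congr expi; rewrite -natr1; ring.
Qed.

Lemma expiV t : (expi t)^-1 = expi (- t) :> R[i].
Proof.
have H : expi (- t) * expi t = 1 :> R[i] by rewrite -expiD addNr expi0.
have n0 : expi t != 0 :> R[i].
  by apply/eqP => E; move: H; rewrite E mulr0 => /eqP; rewrite eq_sym oner_eq0.
by apply: (mulIf n0); rewrite H mulVf.
Qed.

Lemma evalC_Phi_sum (a : nat -> R) n (z : R[i]) :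
  evalC (Phi a n) z = \sum_(l < n.+1) (real_complex R ((Phi a n)`_l)) * z ^+ l.
Proof.
rewrite /evalC (@horner_coef_wide _ n.+1); last first.
  by rewrite (leq_trans (size_poly _ _))// (size_Phi a n).1.
by apply: eq_bigr => l _; rewrite coef_map.
Qed.

Lemma real_complexM_expi (c t : R) :
  real_complex R c * expi t = ((c * cos t)%R +i* (c * sin t)%R)%C.
Proof.
by apply/eqP; rewrite eq_complex /= !mul0r subr0 addr0 !eqxx.
Qed.

Lemma complex_sum (I : Type) (r : seq I) (F G : I -> R) :
  \sum_(i <- r) (F i +i* G i)%C = ((\sum_(i <- r) F i) +i* (\sum_(i <- r) G i))%C.
Proof.
elim: r => [|i r IH]; first by rewrite !big_nil.
by rewrite !big_cons IH.
Qed.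

End ComplexSums.

Lemma jacobi_elliptic_triple (R : realType) (k : R) : 0 < k -> k < 1 ->
  elliptic_triple (k ^+ 2) (jacobi_sn k) (jacobi_cn k) (jacobi_dn k).
Proof.
move=> k0 k1; split.
- exact: jacobi_sn0.
- exact: jacobi_cn0.
- exact: jacobi_dn0.
- exact: jacobi_snN.
- exact: jacobi_cnN.
- exact: jacobi_dnN.
- exact: jacobi_cn2.
- exact: jacobi_dn2.
- exact: jacobi_cnB.
- exact: jacobi_dnB.
Qed.

Theorem theorem1 (R : realType) (k w : R) (hk0 : 0 < k) (hk1 : k < 1)
    (hw : irrational (w / ellipticK k)) (a : nat -> R)
    (ha_even : forall n : nat, a (2 * n)%N = jacobi_cn k (w * (2 * n + 1)%:R))
    (ha_odd : forall n : nat,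
      a (2 * n + 1)%N = - jacobi_dn k (w * (2 * n + 2)%:R)) :
  forall n m : nat,
    zsum_to
      (fun s : int => (real_complex R (weight k s)
                        * evalC (Phi a n) (node k w s)
                        * evalC (Phi a m) (node k w s)^-1))
      (real_complex R (hnorm a n * (n == m)%:R)).
Proof.
move=> n m.
have aE i : a i = if odd i then - jacobi_dn k (w * i.+1%:R) else jacobi_cn k (w * i.+1%:R).
  have := odd_double_half i; rewrite -mul2n; case: odd => /= <-.
    by rewrite addnC ha_odd; congr (- jacobi_dn k (w * _%:R)); lia.
  by rewrite add0n ha_even; congr (jacobi_cn k (w * _%:R)); lia.
(* The node of index s to the power l - j has the argument odd_freq s * arg l j. *)
pose arg (l j : nat) := pi * (w * l%:R - w * j%:R) / (2 * ellipticK k).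
pose F (X : R -> R) s := \sum_(l < n.+1) \sum_(j < m.+1)
  (Phi a n)`_l * (Phi a m)`_j * (weight k s * X (odd_freq R s * arg l j)).
have K0 : ellipticK k != 0 by rewrite gt_eqF// ellipticK_gt0// expr_lt1// ltW.
have term s : real_complex R (weight k s) * evalC (Phi a n) (node k w s)
    * evalC (Phi a m) (node k w s)^-1 = (F cos s +i* F sin s)%C.
  rewrite !evalC_Phi_sum [real_complex R (weight k s) * _]mulr_sumr mulr_suml
    /F -complex_sum; apply: eq_bigr => l _.
  rewrite mulr_sumr -complex_sum; apply: eq_bigr => j _.
  rewrite /node expiV !expi_natr.
  set t := pi * w * _ / _.
  rewrite [LHS](_ : _ = real_complex R ((Phi a n)`_l * (Phi a m)`_j * weight k s) *
    (expi (l%:R * t) * expi (j%:R * - t))); last by rewrite !rmorphM /=; ring.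
  rewrite -expiD real_complexM_expi -!mulrA.
  have -> : l%:R * t + j%:R * - t = odd_freq R s * arg l j.
    by rewrite /t /arg /odd_freq intrB intrM; move: (@pi R) => P; field.
  by [].
have Fs (X : R -> R) : (forall y, `|X y| <= 1) -> zsummable (F X).
  move=> X1; apply: zsummable_sum => l; apply: zsummable_sum => j.
  apply: zsummableZ; exact: weight_summable.
have FE (X : R -> R) : (forall y, `|X y| <= 1) -> zsum (F X) =
    \sum_(l < n.+1) \sum_(j < m.+1) (Phi a n)`_l * (Phi a m)`_j *
      zsum (fun s => weight k s * X (odd_freq R s * arg l j)).
  move=> X1; have ws (l j : nat) := @weight_summable _ _ hk0 hk1 X (arg l j) X1.
  rewrite /F zsum_sum; last first.
    by move=> l; apply: zsummable_sum => j; exact: zsummableZ.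
  apply: eq_bigr => l _; rewrite zsum_sum; last by move=> j; exact: zsummableZ.
  by apply: eq_bigr => j _; rewrite zsumZ.
have -> : real_complex R (hnorm a n * (n == m)%:R) = (zsum (F cos) +i* zsum (F sin))%C.
  rewrite !FE; [|exact: sin_max|exact: cos_max].
  rewrite -(Phi_gram_sym (jacobi_elliptic_triple hk0 hk1) aE).
  congr (_ +i* _)%C.
    by apply: eq_bigr => l _; apply: eq_bigr => j _; rewrite /arg weight_cos.
  by rewrite big1// => l _; rewrite big1// => j _; rewrite weight_sin ?mulr0.
under [fun s => _]eq_fun do rewrite term.
apply: zsum_to_complex; apply: Fs; [exact: cos_max|exact: sin_max].
Qed.
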